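(* Let $0<\lambda\le1$ and let $p(\cdot)\in\mathcal P(0,\infty)$ satisfy $p(\cdot)\in LH_0(0,\infty)\cap LH_\infty(0,\infty)$ and $1<p^-\le p^+<\frac1{1-\lambda}$ (where $\frac{1}{1-\lambda}=\infty$ if $\lambda=1$). Define $q(\cdot)\in\mathcal P(0,\infty)$ by $1/q(x)=1/p(x)-(1-\lambda)$. If $w$ is a weight on $(0,\infty)$, then the following are equivalent: (i) $\mathcal C_\lambda$ is of strong-type $(p(\cdot),q(\cdot))$ with respect to $w$; (ii) $S_\lambda$ is of strong-type $(p(\cdot),q(\cdot))$ with respect to $w$; (iii) $\mathcal C_\lambda$ is of weak-type $(p(\cdot),q(\cdot))$ with respect to $w$; (iv) $S_\lambda$ is of weak-type $(p(\cdot),q(\cdot))$ with respect to $w$; (v) $w\in A_{p(\cdot),q(\cdot),0}$.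
   Context: $\mathcal P(0,\infty)$ is the set of bounded measurable functions $p(\cdot):(0,\infty)\to[1,\infty)$; $p^-=\inf_{x>0}p(x)$ and $p^+=\sup_{x>0}p(x)$. The conjugate exponent is defined pointwise by $1/p(x)+1/p'(x)=1$. For $r(\cdot)\in\mathcal P(0,\infty)$ and measurable $f$, $\|f\|_{r(\cdot)}=\inf\{\mu>0:\int_0^\infty(|f(x)|/\mu)^{r(x)}\,dx\le1\}\in[0,\infty]$. $p(\cdot)\in LH_0(0,\infty)$ means there are $C_0>0$, $p_0\ge1$ with $|p(x)-p_0|\le \frac{C_0}{-\log x}$ for all $0<x<1/2$. $p(\cdot)\in LH_\infty(0,\infty)$ means there are $C_\infty>0$, $p_\infty\ge1$ with $|p(x)-p_\infty|\le\frac{C_\infty}{\log(e+x)}$ for all $x\in(0,\infty)$. A weight is a non-negative, locally integrable function $w$ on $(0,\infty)$ with $0<w(x)<\infty$ a.e. $L^{p(\cdot)}_w(0,\infty)$ is the set of measurable $f$ with $\|fw\|_{p(\cdot)}<\infty$. For non-negative measurable $f$ on $(0,\infty)$ (values in $[0,\infty]$ allowed for the results), $$S_\lambda f(x)=\int_0^\infty\frac{f(y)}{(x+y)^\lambda}\,dy,\qquad \mathcal C_\lambda f(x)=\frac1{x^\lambda}\int_0^xf(y)\,dy+\int_x^\infty\frac{f(y)}{y^\lambda}\,dy .$$ Such an operator $T$ is of strong-type $(p(\cdot),q(\cdot))$ with respect to $w$ if there is $K>0$ such that $\|(Tf)w\|_{q(\cdot)}\le K\|fw\|_{p(\cdot)}$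 for all non-negative $f\in L^{p(\cdot)}_w(0,\infty)$; it is of weak-type $(p(\cdot),q(\cdot))$ with respect to $w$ if there is $K>0$ such that $\mu\|w\chi_{\{x\in(0,\infty):Tf(x)>\mu\}}\|_{q(\cdot)}\le K\|fw\|_{p(\cdot)}$ for all $\mu>0$ and all such $f$. $w\in A_{p(\cdot),q(\cdot),0}$ means there is $C>0$ such that $\|w\chi_{(0,b)}\|_{q(\cdot)}\|w^{-1}\chi_{(0,b)}\|_{p'(\cdot)}\le Cb^\lambda$ for every $b>0$. *)

(* Defs.v *)
From HB Require Import structures.
From mathcomp Require Import all_boot all_order all_algebra.
From mathcomp Require Import all_classical all_reals all_analysis.
From mathcomp Require Import measurable_realfun.

Set Implicit Arguments.
Unset Strict Implicit.
Unset Printing Implicit Defensive.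

Import Order.TTheory GRing.Theory Num.Theory.
Import numFieldNormedType.Exports.

Local Open Scope classical_set_scope.
Local Open Scope ring_scope.
Local Open Scope ereal_scope.

(* [lebesgueR R] is [R] with the sigma-algebra of Lebesgue (not only Borel)   *)
(* measurable sets. Functions on (0, +oo) are total functions on [R] whose    *)
(* values outside (0, +oo) are never used.                                    *)
Definition lebesgue_display (R : realType) : measure_display :=
  caratheodory_display (@wlength R idfun)^*%mu.

Definition lebesgueR (R : realType) : measurableType (lebesgue_display R) :=
  caratheodory_type (@wlength R idfun)^*%mu.

Definition leb {R : realType} : {measure set lebesgueR R -> \bar R} :=
  @completed_lebesgue_measure R.

Definition posR {R : realType} : set R := `]0%R, +oo[%classic.

Definition lmeas_fun {R : realType} {d : measure_display}
    {U : measurableType d} (f : R -> U) : Prop :=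
  @measurable_fun _ _ (lebesgueR R) U posR f.

Definition exponent {R : realType} (p : R -> R) : Prop :=
  [/\ lmeas_fun p,
      (forall x : R, (0 < x)%R -> (1 <= p x)%R) &
      exists M : R, forall x : R, (0 < x)%R -> (p x <= M)%R].

Definition exp_inf {R : realType} (p : R -> R) : \bar R :=
  ereal_inf [set (p x)%:E | x in posR].

Definition exp_sup {R : realType} (p : R -> R) : \bar R :=
  ereal_sup [set (p x)%:E | x in posR].

(* Meaningful only where [1 < p x]: the infinite conjugate of 1 is not        *)
(* representable, [conj_exp p x] is 0 when [p x = 1].                         *)
Definition conj_exp {R : realType} (p : R -> R) (x : R) : R :=
  ((1 - (p x)^-1)^-1)%R.

Definition LH0 {R : realType} (p : R -> R) : Prop :=
  exists C0 p0 : R, [/\ (0 < C0)%R, (1 <= p0)%R &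
    forall x : R, (0 < x < 2^-1)%R -> (`|p x - p0| <= C0 / - ln x)%R].

Definition LHoo {R : realType} (p : R -> R) : Prop :=
  exists Coo poo : R, [/\ (0 < Coo)%R, (1 <= poo)%R &
    forall x : R, (0 < x)%R -> (`|p x - poo| <= Coo / ln (expR 1 + x))%R].

(* The infimum of the empty set is +oo. *)
Definition vnorm {R : realType} (r : R -> R) (f : R -> \bar R) : \bar R :=
  ereal_inf [set mu%:E | mu in [set mu : R | (0 < mu)%R /\
    \int[leb]_(x in posR) (`|f x| * (mu^-1)%:E) `^ (r x) <= 1]].

(* [w] may take the values 0 and +oo on a null set; there [w^-1] is +oo and   *)
(* 0 respectively, and [0 * +oo = 0].                                         *)
Definition weight {R : realType} (w : R -> \bar R) : Prop :=
  [/\ lmeas_fun w,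
      (forall x : R, (0 < x)%R -> 0 <= w x),
      (forall K : set R, K `<=` posR -> compact K -> leb.-integrable K w) &
      {ae leb, forall x : lebesgueR R, (0 < x :> R)%R -> 0 < w x < +oo}].

Definition Lw {R : realType} (p : R -> R) (w f : R -> \bar R) : Prop :=
  lmeas_fun f /\ vnorm p (fun x => f x * w x) < +oo.

Definition Sop {R : realType} (lam : R) (f : R -> \bar R) (x : R) : \bar R :=
  \int[leb]_(y in posR) (f y * (((x + y) `^ lam)^-1)%:E).

Definition Cop {R : realType} (lam : R) (f : R -> \bar R) (x : R) : \bar R :=
  ((x `^ lam)^-1)%:E * \int[leb]_(y in `]0%R, x[%classic) f y +
  \int[leb]_(y in `]x, +oo[%classic) (f y * ((y `^ lam)^-1)%:E).

Definition strong_type {R : realType} (p q : R -> R) (w : R -> \bar R)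
    (T : (R -> \bar R) -> R -> \bar R) : Prop :=
  exists2 K : R, (0 < K)%R &
    forall f : R -> \bar R, (forall x : R, (0 < x)%R -> 0 <= f x) -> Lw p w f ->
      vnorm q (fun x => T f x * w x) <= K%:E * vnorm p (fun x => f x * w x).

Definition weak_type {R : realType} (p q : R -> R) (w : R -> \bar R)
    (T : (R -> \bar R) -> R -> \bar R) : Prop :=
  exists2 K : R, (0 < K)%R &
    forall (mu : R) (f : R -> \bar R), (0 < mu)%R ->
      (forall x : R, (0 < x)%R -> 0 <= f x) -> Lw p w f ->
      mu%:E * vnorm q (fun x =>
        w x * (\1_[set y : R | (0 < y)%R /\ (mu%:E < T f y)%E] x)%:E)
      <= K%:E * vnorm p (fun x => f x * w x).

Definition Apq0 {R : realType} (lam : R) (p q : R -> R) (w : R -> \bar R)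
    : Prop :=
  exists2 C : R, (0 < C)%R &
    forall b : R, (0 < b)%R ->
      vnorm q (fun x => w x * (\1_(`]0%R, b[%classic : set R) x)%:E) *
      vnorm (conj_exp p)
        (fun x => (w x)^-1 * (\1_(`]0%R, b[%classic : set R) x)%:E)
      <= (C * b `^ lam)%:E.

(* Main.v *)
Require Import Defs.
From HB Require Import structures.
From mathcomp Require Import all_boot all_order all_algebra.
From mathcomp Require Import all_classical all_reals all_analysis.
From mathcomp Require Import measurable_realfun.
From mathcomp Require Import ring lra zify.

(* C_lam f(x) is the integral of f(y) / max(x, y)^lam, so S_lam <= C_lam <= 2^lam S_lam and
   the two operators have the same strong and weak types.

   (iv) => (v): S_lam f is at least (2b)^-lam int_0^b f on (0, b); testing with
   f = A (w^-1 / A)^p' on the sets {1/n <= w <= n} in (0, b), where A is K (2b)^lam divided by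
   the norm of w on (0, b), bounds the modular of w^-1 at A by 1.

   (v) => (i): since 1/q + 1/p' = lam is constant, Hoelder's inequality gives the converse of
   (v) on the dyadic intervals J_k = [2^(k-1), 2^k). Hence the norm of w on (0, 2^(k-1)) is at
   most th < 1 times its norm on (0, 2^k), and likewise for w^-1. The kernel of C_lam between J_k
   and J_j therefore has norm at most B rho^|j-k| with rho < 1. The log-Hoelder conditions
   say that on J_k the exponent p differs from a constant P_k by O(1 / (1 + |k|)), where P_k
   takes one value for k > 0 and another for k <= 0; such an error is harmless for powers of
   numbers that are at least a constant times s^|k|. Dominating the sequence
   int_(J_k) (f w)^p by a summable G with G_j >= s^|j-k| G_k, s^2 = rho, reduces the estimate
   to a geometric series. *)

Set Implicit Arguments.
Unset Strict Implicit.
Unset Printing Implicit Defensive.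

Import Order.TTheory GRing.Theory Num.Theory.
Import numFieldNormedType.Exports.

Local Open Scope classical_set_scope.
Local Open Scope ring_scope.
Local Open Scope ereal_scope.

(** * Nonnegative integrals *)

Section integrals.
Context d (T : measurableType d) (R : realType) (mu : {measure set T -> \bar R}).

(* No measurability is assumed: the integral of a nonnegative function is a supremum over
   simple functions. *)
Lemma ge0_le_integral_nonmeas (D : set T) (f g : T -> \bar R) :
  (forall x, D x -> 0 <= f x) -> (forall x, D x -> f x <= g x) ->
  \int[mu]_(x in D) f x <= \int[mu]_(x in D) g x.
Proof.
move=> f0 fg.
rewrite integral_mkcond [leRHS]integral_mkcond.
have f0' x : 0 <= (f \_ D) x by apply: erestrict_ge0.
have fg' x : (f \_ D) x <= (g \_ D) x by apply: lee_restrict.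
have g0' x : 0 <= (g \_ D) x by exact: le_trans (fg' x).
rewrite !ge0_integralTE//.
apply: ereal_sup_le => _ [h hf <-]; exists h => // x.
exact: le_trans (fg' x).
Qed.

Lemma measurable_fun_if_in d' (U : measurableType d') (D : set T)
    (b : T -> bool) (f g : T -> U) :
  measurable D -> measurable_fun D b -> measurable_fun D f ->
  measurable_fun D g -> measurable_fun D (fun x => if b x then f x else g x).
Proof.
by move=> mD mb mf mg; apply: measurable_fun_if => //;
  [exact: measurable_funS mf|exact: measurable_funS mg].
Qed.

Lemma measurable_fun_powR (D : set T) (f r : T -> R) :
  measurable D -> measurable_fun D f -> measurable_fun D r ->
  measurable_fun D (fun x => powR (f x) (r x)).
Proof.
move=> mD mf mr; rewrite /powR; apply: measurable_fun_if_in => //.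
- exact: measurable_fun_eqr.
- rewrite [X in measurable_fun _ X](_ : _ =
    fun x => if r x == 0%R then 1%R else 0%R : R); last first.
    by apply/funext => x; case: ifP.
  by apply: measurable_fun_if_in => //; exact: measurable_fun_eqr.
- apply: measurableT_comp => //; apply: measurable_funM => //.
  exact: measurableT_comp.
Qed.

(** The exponent varies with the point, so measurability is read off from the case distinction that
    defines the extended power. *)
Lemma measurable_fun_poweR (D : set T) (f : T -> \bar R) (r : T -> R) :
  measurable D -> measurable_fun D f -> measurable_fun D r ->
  measurable_fun D (fun x => f x `^ r x).
Proof.
move=> mD mf mr.
have mfin : measurable_fun D (fun x => fine (f x)).
  by apply: measurableT_comp => //; exact: fine_measurable.
have mpow : measurable_fun D (fun x => powR (fine (f x)) (r x)).
  exact: measurable_fun_powR.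
under eq_fun do rewrite poweRE fin_numE.
apply: measurable_fun_if_in => //; first exact: measurable_fun_eqr.
  apply/measurable_EFinP; apply: measurable_fun_if_in => //.
  by apply: measurable_and; apply: measurable_neg; exact: measurable_fun_eqe.
apply: measurable_fun_if_in => //; first exact: measurable_fun_eqe.
apply: measurable_fun_if_in => //; first exact: measurable_fun_eqe.
exact/measurable_EFinP.
Qed.

Lemma measurable_fun_inve (D : set T) (f : T -> \bar R) :
  measurable D -> measurable_fun D f -> (forall x, D x -> 0 <= f x) ->
  measurable_fun D (fun x => (f x)^-1).
Proof.
move=> mD mf f0.
(* The extended inverse is [+oo] at 0 and 0 at [+oo]; between them it is a real power. *)
pose g x := if f x == 0 then +oo else if f x == +oo then 0
  else (powR (fine (f x)) (-1))%:E.
apply: (@eq_measurable_fun _ _ _ _ _ g).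
  move=> x; rewrite inE => Dx; rewrite /g.
  have := f0 _ Dx; case: (f x) => [y||]//= y0.
  by rewrite inver eqe; case: ifPn => // ?; rewrite powR_inv1.
apply: measurable_fun_if_in => //; first exact: measurable_fun_eqe.
apply: measurable_fun_if_in => //; first exact: measurable_fun_eqe.
apply/measurable_EFinP.
apply: (measurableT_comp (measurable_powR _)).
by apply: measurableT_comp => //; exact: fine_measurable.
Qed.
Lemma ge0_integral_lincomb (D : set T) (f g : T -> \bar R) (c e : R) :
  measurable D -> (0 <= c)%R -> (0 <= e)%R ->
  measurable_fun D f -> measurable_fun D g ->
  (forall x, D x -> 0 <= f x) -> (forall x, D x -> 0 <= g x) ->
  \int[mu]_(x in D) (c%:E * f x + e%:E * g x) =
  c%:E * \int[mu]_(x in D) f x + e%:E * \int[mu]_(x in D) g x.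
Proof.
move=> mD c0 e0 mf mg f0 g0.
rewrite ge0_integralD//.
- by rewrite !ge0_integralZl.
- by move=> x Dx; apply: mule_ge0; [rewrite lee_fin|exact: f0].
- exact: measurable_funeM.
- by move=> x Dx; apply: mule_ge0; [rewrite lee_fin|exact: g0].
- exact: measurable_funeM.
Qed.

(** The form in which Young's inequality is integrated: for weights it holds only where they are
    positive and finite, hence almost everywhere. *)
Lemma ae_ge0_le_integral_lincomb (D : set T) (h f g : T -> \bar R) (c e : R) :
  measurable D -> (0 <= c)%R -> (0 <= e)%R ->
  measurable_fun D h -> measurable_fun D f -> measurable_fun D g ->
  (forall x, D x -> 0 <= h x) ->
  (forall x, D x -> 0 <= f x) -> (forall x, D x -> 0 <= g x) ->
  {ae mu, forall x, D x -> h x <= c%:E * f x + e%:E * g x} ->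
  \int[mu]_(x in D) h x <= c%:E * \int[mu]_(x in D) f x + e%:E * \int[mu]_(x in D) g x.
Proof.
move=> mD c0 e0 mh mf mg h0 f0 g0 hfg.
rewrite -ge0_integral_lincomb//; apply: ae_ge0_le_integral => //.
- move=> x Dx; apply: adde_ge0; apply: mule_ge0;
    rewrite ?lee_fin ?f0 ?g0//.
- by apply: emeasurable_funD; exact: measurable_funeM.
Qed.

End integrals.

Section leb.
Context {R : realType}.

Lemma borel_leb_measurable (A : set R) : @measurable _ (measurableTypeR R) A ->
  @measurable _ (lebesgueR R) A.
Proof. by move=> mA; apply: sub_caratheodory. Qed.

Lemma lebE (A : set R) : leb A = @lebesgue_measure R A.
Proof. by []. Qed.

Lemma measurable_fun_leb d (U : measurableType d) (D : set R) (g : R -> U) :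
  @measurable _ (lebesgueR R) D ->
  @measurable_fun _ _ (measurableTypeR R) U setT g ->
  @measurable_fun _ _ (lebesgueR R) U D g.
Proof.
move=> mD mg _ Y mY; apply: measurableI => //.
by apply: borel_leb_measurable; rewrite -[X in measurable X]setTI; exact: mg.
Qed.

Lemma measurable_itv_leb (i : interval R) : @measurable _ (lebesgueR R) [set` i].
Proof. by apply: borel_leb_measurable; exact: measurable_itv. Qed.

Lemma leb_integralZl (D : set R) (f : R -> \bar R) (k : R) :
  @measurable _ (lebesgueR R) D -> (0 <= k)%R ->
  @measurable_fun _ _ (lebesgueR R) _ D f -> (forall x, D x -> 0 <= f x) ->
  \int[leb]_(x in D) (k%:E * f x) = k%:E * \int[leb]_(x in D) f x.
Proof.
move=> mD k0 mf f0.
exact: (@ge0_integralZl _ (lebesgueR R) R leb D mD f mf k%:E f0).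
Qed.

End leb.

(** * Series indexed by the integers *)

Section int_sums.
Context {R : realType}.
Implicit Types (a b : int -> \bar R).

Lemma le_esumZl (T : choiceType) (A : set T) (a : T -> \bar R) (c : R) :
  (0 <= c)%R -> (forall i, 0 <= a i) ->
  \esum_(i in A) (c%:E * a i) <= c%:E * \esum_(i in A) a i.
Proof.
move=> c0 a0; apply: ge_ereal_sup => _ [X [finX XA] <-].
rewrite -ge0_mule_fsumr//; apply: lee_wpmul2l; first by rewrite lee_fin.
by apply: ereal_sup_ubound; exists X.
Qed.

Lemma exchange_esum (T T' : choiceType) (a : T -> T' -> \bar R) :
  (forall i j, 0 <= a i j) ->
  \esum_(i in [set: T]) \esum_(j in [set: T']) a i j =
  \esum_(j in [set: T']) \esum_(i in [set: T]) a i j.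
Proof.
move=> a0; rewrite !esum_esum//.
rewrite (reindex_esum ([set: T'] `*`` (fun=> [set: T])) _ (fun x => (x.2, x.1)))//.
split=> //=.
- by move=> [i1 i2] [j1 j2] /= _ _ [] -> ->.
- by move=> [i1 i2] _ /=; exists (i2, i1).
Qed.

Lemma esum_intE a : (forall k, 0 <= a k) ->
  \esum_(k in [set: int]) a k =
  \sum_(n <oo) a (Posz n) + \sum_(n <oo) a (Negz n).
Proof.
move=> a0; rewrite (esumID (range Posz))//.
rewrite setTI (_ : [set: int] `&` ~` range Posz = range Negz); last first.
  apply/seteqP; split=> [[n [_ []]|n _]|_ [n _ <-]] /=.
  - by exists n.
  - by exists n.
  - by split=> // -[].
by rewrite !esum_image ?nneseries_esumT// => m n _ _ [].
Qed.

Lemma nneseries_geometric (s : R) : (0 < s < 1)%R ->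
  \sum_(n <oo) (s ^+ n)%:E = ((1 - s)^-1)%:E.
Proof.
move=> /andP[s0 s1].
have cs : (`|s| < 1)%R by rewrite gtr0_norm.
have := @cvg_geometric_series R 1%R s cs; rewrite mul1r => h.
rewrite -(cvg_lim (@Rhausdorff R) h) -EFin_lim; last by apply/cvg_ex; exists (1 - s)^-1%R.
apply/congr_lim/funext => n /=.
rewrite seriesEord/= -sumEFin big_mkord.
by apply: eq_bigr => i _; rewrite /geometric/= mul1r.
Qed.

(** The substitution of [j - k] for [k] removes [j], and two geometric series remain. *)
Lemma esum_int_geometric (s : R) : (0 < s < 1)%R ->
  exists2 C : R, (0 < C)%R & forall j : int,
    \esum_(k in [set: int]) (s ^+ `|j - k|%N)%:E <= C%:E.
Proof.
move=> /[dup] s01 /andP[s0 s1]; exists (2 * (1 - s)^-1)%R.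
  by rewrite mulr_gt0// invr_gt0 subr_gt0.
move=> j.
rewrite (reindex_esum [set: int] [set: int] (fun k => j - k)%R); last first.
  split=> //.
  - by move=> m n _ _ /addrI/oppr_inj.
  - by move=> k _; exists (j - k)%R => //; rewrite opprB addrCA subrr addr0.
under eq_esum do rewrite opprB addrCA subrr addr0.
rewrite esum_intE; last by move=> k; rewrite lee_fin exprn_ge0// ltW.
(* [Negz n] is [-(n + 1)], so the negative half is dominated by the same series as the nonnegative
   half. *)
rewrite nneseries_geometric// mulrDl mul1r EFinD leeD2l//.
rewrite -(nneseries_geometric s01); apply: lee_nneseries => n _ /=.
  by rewrite lee_fin exprn_ge0// ltW.
by rewrite lee_fin; apply: ler_wiXn2l; [exact: ltW|exact: ltW|].
Qed.

End int_sums.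

Section regularize.
Context {R : realType}.

Lemma esum_ge_term (T : choiceType) (a : T -> \bar R) (k : T) :
  (forall i, 0 <= a i) -> a k <= \esum_(i in [set: T]) a i.
Proof.
move=> a0; apply: esum_ge; exists [set k]; last by rewrite fsbig_set1.
by split=> //; exact: finite_set1.
Qed.

(* The witness is [m_k + s^|k|] convolved with [s^|k|] and normalized. *)
Lemma slowly_varying_majorant (s : R) : (0 < s < 1)%R ->
  exists2 C : R, (1 <= C)%R & forall m : int -> \bar R,
    (forall k, 0 <= m k) -> \esum_(k in [set: int]) m k <= 1 ->
    exists G : int -> R,
    [/\ forall k, (0 < G k <= 1)%R,
        \esum_(k in [set: int]) (G k)%:E <= 1,
        forall k, m k <= (C * G k)%:E,
        forall k, (s ^+ `|k|%N <= C * G k)%R &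
        forall j k, (s ^+ `|j - k|%N * G k <= G j)%R].
Proof.
move=> /[dup] s01 /andP[s0 s1].
have [C C0 HC] := esum_int_geometric s01.
have sn0 n : (0 < s ^+ n)%R by rewrite exprn_gt0.
have C1 : (1 <= C)%R.
  rewrite -lee_fin; apply: le_trans (HC 0%R).
  rewrite -[leLHS](_ : (s ^+ `|0 - 0 : int|%N)%:E = 1); last by rewrite subrr expr0.
  by apply: (esum_ge_term (a := fun k : int => (s ^+ `|0 - k|%N)%:E)) => i;
    rewrite lee_fin ltW.
(* Bounds the total mass of the convolution: at most [C] for the kernel, at most [1 + C] for [h]. *)
pose D := (C * (1 + C))%R.
have D1 : (1 <= D)%R by rewrite /D; nra.
have D0 : (0 < D)%R by lra.
exists D => // m m0 sm.
have m1 k : m k <= 1 by apply: le_trans sm; exact: esum_ge_term.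
(* The added power of [s] keeps [G] positive where [m] vanishes and gives its geometric lower
   bound. *)
pose h k := (fine (m k) + s ^+ `|k|%N)%R.
have mfin k : m k = (fine (m k))%:E.
  by rewrite fineK// fin_numE; have := m0 k; have := m1 k; case: (m k).
have fm0 k : (0 <= fine (m k))%R by rewrite fine_ge0.
have h0 k : (0 <= h k)%R by rewrite addr_ge0// ltW.
pose H j := \esum_(k in [set: int]) (s ^+ `|j - k|%N * h k)%:E.
have t0 j k : (0 <= s ^+ `|j - k|%N * h k)%R by rewrite mulr_ge0// ltW.
have H0 j : 0 <= H j by apply: esum_ge0 => k _; rewrite lee_fin.
have sh : \esum_(k in [set: int]) (h k)%:E <= (1 + C)%:E.
  under eq_esum do rewrite /h EFinD -mfin.
  rewrite esumD//; last by move=> k _; rewrite lee_fin ltW.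
  rewrite EFinD leeD//; apply: le_trans (HC 0%R).
  by apply: le_esum => k _; rewrite sub0r abszN.
have sH : \esum_(j in [set: int]) H j <= D%:E.
  rewrite exchange_esum; last by move=> i j; rewrite lee_fin.
  apply: (@le_trans _ _ (\esum_(k in [set: int]) (C%:E * (h k)%:E))).
    apply: le_esum => k _; under eq_esum do rewrite mulrC EFinM.
    apply: le_trans (le_esumZl _ _ _) _ => //.
      by move=> i; rewrite lee_fin ltW.
    rewrite muleC lee_wpmul2r ?lee_fin//.
    by under eq_esum do rewrite distnC; exact: HC.
  have hh0 k : 0 <= (h k)%:E by rewrite lee_fin.
  apply: le_trans (le_esumZl _ (ltW C0) hh0) _.
  by rewrite /D EFinM lee_wpmul2l// lee_fin ltW.
have HD j : H j <= D%:E by apply: le_trans sH; exact: esum_ge_term.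
have Hfin j : H j = (fine (H j))%:E.
  by rewrite fineK// fin_numE; have := H0 j; have := HD j; case: (H j).
(* The diagonal term of the convolution. *)
have hH k : (h k <= fine (H k))%R.
  rewrite -lee_fin -Hfin.
  have := esum_ge_term k (fun l => (_ : 0 <= (s ^+ `|k - l|%N * h l)%:E)).
  by rewrite subrr expr0 mul1r; apply => l; rewrite lee_fin.
exists (fun j => fine (H j) / D)%R; split.
- move=> k; apply/andP; split.
    by rewrite divr_gt0// (lt_le_trans _ (hH k))// /h ltr_wpDl.
  by rewrite ler_pdivrMr// mul1r -lee_fin -Hfin.
- under eq_esum do rewrite mulrC EFinM -Hfin.
  have D0' : (0 <= D^-1)%R by rewrite invr_ge0 ltW.
  apply: le_trans (le_esumZl _ D0' H0) _.
  apply: (@le_trans _ _ (D^-1%:E * D%:E)).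
    by rewrite lee_wpmul2l// lee_fin invr_ge0 ltW.
  by rewrite -EFinM mulVf// gt_eqF.
- move=> k; rewrite mulrCA divff ?gt_eqF// mulr1 mfin lee_fin.
  by apply: le_trans (hH k); rewrite lerDl ltW.
- move=> k; rewrite mulrCA divff ?gt_eqF// mulr1.
  by apply: le_trans (hH k); rewrite lerDr.
(* Slow variation holds term by term in the convolution, since [|j - l| <= |j - k| + |k - l|]. *)
- move=> j k; rewrite mulrA ler_pM2r ?invr_gt0//.
  rewrite mulrC -ler_pdivlMr// -lee_fin -Hfin EFinM -Hfin muleC.
  apply: (@le_trans _ _ (\esum_(l in [set: int])
      ((s ^+ `|j - k|)^-1%:E * (s ^+ `|j - l|%N * h l)%:E))); last first.
    by apply: le_esumZl => // ; rewrite ?invr_ge0 ?ltW// => i; rewrite lee_fin.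
  apply: le_esum => l _; rewrite -EFinM lee_fin mulrA ler_wpM2r//.
  rewrite mulrC ler_pdivlMr// -exprD; apply: ler_wiXn2l; [exact: ltW|exact: ltW|].
  lia.
Qed.

End regularize.

(** * Dyadic intervals *)

Section exponents.
Context {R : realType}.
Local Open Scope ring_scope.

(** The factor t^(a-b) is at most (1/t)^(L/(n+1)), and 1/t <= C/s^n <= (C/s)^(n+1), so the [n + 1]
    cancels and a constant independent of [n] is left. *)
Lemma powR_exponent_perturb (s C L t a b : R) (n : nat) :
  0 < s < 1 -> 1 <= C -> 0 < t <= 1 -> s ^+ n <= C * t ->
  `|a - b| <= L / n.+1%:R -> t `^ a <= (C / s) `^ L * t `^ b.
Proof.
move=> /andP[s0 s1] C1 /[dup] t01 /andP[t0 t1] snt abL.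
have n0 : 0 < n.+1%:R :> R by rewrite ltr0n.
have L0 : 0 <= L by rewrite -[L](divfK (lt0r_neq0 n0)) mulr_ge0// (le_trans _ abL).
have Cs1 : 1 <= C / s by rewrite ler_pdivlMr// mul1r (le_trans (ltW s1)).
have C0 : 0 < C by lra.
have -> : t `^ a = t `^ (a - b) * t `^ b.
  by rewrite -powRD ?subrK// (gt_eqF t0) implybT.
rewrite ler_wpM2r ?powR_ge0//.
(* As [t <= 1], the worst case is the smallest exponent. *)
apply: (@le_trans _ _ (t `^ (- (L / n.+1%:R)))).
  apply: ger_powR => //; move: abL; by rewrite ler_norml => /andP[].
rewrite powRN.
have -> : ((t `^ (L / n.+1%:R))^-1 = (t ^-1) `^ (L / n.+1%:R)).
  rewrite -[in RHS](@powR_inv1 _ t); last exact: ltW.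
  by rewrite powRAC powR_inv1// powR_ge0.
have -> : (C / s) `^ L = ((C / s) ^+ n.+1) `^ (L / n.+1%:R).
  rewrite -(@powR_mulrn _ (C / s)); last lra.
  by rewrite -powRrM mulrCA divff ?mulr1// gt_eqF.
apply: ge0_ler_powR; rewrite ?nnegrE.
- by rewrite divr_ge0// ltW.
- by rewrite invr_ge0 ltW.
- by rewrite exprn_ge0//; lra.
have sn0 : 0 < s ^+ n by rewrite exprn_gt0.
apply: (@le_trans _ _ (C / s ^+ n)).
  by rewrite ler_pdivlMr// mulrC ler_pdivrMr// mulrC// mulrC.
rewrite expr_div_n ler_pdivrMr// mulrAC ler_pdivlMr ?exprn_gt0//.
rewrite exprS mulrCA mulrA; apply: ler_pM => //.
- by rewrite mulr_ge0// ltW.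
- exact: ltW.
- rewrite mulrC; apply: (@le_trans _ _ (C * 1)); first by rewrite ler_pM2l// ltW.
  by rewrite mulr1 exprS ler_peMr ?exprn_ege1// ltW.
Qed.

End exponents.

(* [card_set_bijP] needs a pointed codomain. *)
HB.instance Definition _ := isPointed.Build int 0%R.

Section dyadic.
Context {R : realType}.
Local Open Scope ring_scope.

(** The interval [J_k], of length 2^(k-1); half-open, so that these intervals partition the
    half-line. *)
Definition dyadic_itv (k : int) : set R := `[(2 : R) ^ (k - 1), (2 : R) ^ k[%classic.

Lemma exp2z_gt0 (k : int) : 0 < (2 : R) ^ k.
Proof. by rewrite exprz_gt0. Qed.

Lemma exp2z_pred (k : int) : (2 : R) ^ k = 2 * 2 ^ (k - 1).
Proof. by rewrite -{2}(expr1z (2 : R)) -expfzDr ?pnatr_eq0// addrCA subrr addr0. Qed.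

Lemma exp2z_le (j k : int) : ((2 : R) ^ j <= 2 ^ k) = (j <= k).
Proof. by rewrite ler_eXz2l// ltr1n. Qed.

Lemma ln_exp2z (k : int) : ln ((2 : R) ^ k) = k%:~R * ln 2.
Proof. by rewrite -powR_intmul ?ln_powR. Qed.

(** This is [ln (1 + x) <= x] at [x = -1/2]. *)
Lemma ln2_ge_half : 2^-1 <= ln (2 : R).
Proof.
have := @le_ln1Dx R (- 2^-1); rewrite -[1 + - _](_ : 2^-1 = _); last lra.
by rewrite lnV ?posrE//; lra.
Qed.

Lemma dyadic_itv_cover (x : R) : 0 < x -> exists k, dyadic_itv k x.
Proof.
move=> x0; have l0 : 0 < ln (2 : R) by have := ln2_ge_half; lra.
have /andP[a b] := floor_itv (ln x / ln 2).
exists (Num.floor (ln x / ln 2) + 1); rewrite /dyadic_itv/= in_itv/=.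
rewrite addrK -ler_ln ?posrE ?exp2z_gt0// -ltr_ln ?posrE ?exp2z_gt0//.
by rewrite !ln_exp2z -ler_pdivlMr// -ltr_pdivrMr// a b.
Qed.

Lemma dyadic_itv_inj (x : R) (j k : int) : dyadic_itv j x -> dyadic_itv k x -> j = k.
Proof.
rewrite /dyadic_itv/= !in_itv/= => /andP[a b] /andP[c d].
have : (2 : R) ^ (j - 1) < 2 ^ k by exact: le_lt_trans d.
have : (2 : R) ^ (k - 1) < 2 ^ j by exact: le_lt_trans b.
rewrite !ltr_eXz2l ?ltr1n//; lia.
Qed.

Lemma dyadic_itv_gt0 (x : R) (k : int) : dyadic_itv k x -> 0 < x.
Proof.
rewrite /dyadic_itv/= in_itv/= => /andP[a _]; apply: lt_le_trans a.
exact: exp2z_gt0.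
Qed.

Lemma dyadic_itv_sub (k : int) : dyadic_itv k `<=` posR.
Proof. by move=> x /dyadic_itv_gt0; rewrite /posR/= in_itv/= andbT. Qed.

Lemma measurable_dyadic (k : int) : @measurable _ (lebesgueR R) (dyadic_itv k).
Proof. exact: measurable_itv_leb. Qed.

Lemma measurable_posR : @measurable _ (lebesgueR R) posR.
Proof. exact: measurable_itv_leb. Qed.

Lemma leb_dyadic (k : int) : leb (dyadic_itv k) = (2 ^ (k - 1))%:E :> \bar R.
Proof.
rewrite lebE lebesgue_measure_itv/= lte_fin.
rewrite (exp2z_pred k) ifT -?EFinB; last by have := exp2z_gt0 (k - 1); lra.
by congr EFin; lra.
Qed.

(** An enumeration of the integers gives access to countable additivity, which is stated for
    sequences of sets. *)
Lemma countable_int_bij : exists e : nat -> int, set_bij [set: nat] [set: int] e.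
Proof.
have : ([set: int] #= [set: nat])%card.
  apply: eq_card_nat; first exact: countableP.
  apply/infiniteP/pcard_leTP/injPex; exists Posz => // m n _ _.
  by case.
by rewrite card_eq_sym => /card_set_bijP.
Qed.

Lemma integral_dyadic (g : R -> \bar R) :
  @measurable_fun _ _ (lebesgueR R) _ posR g -> (forall x, 0 < x -> (0 <= g x)%E) ->
  (\int[leb]_(x in posR) g x = \esum_(k in [set: int]) \int[leb]_(x in dyadic_itv k) g x)%E.
Proof.
move=> mg g0.
have [e ebij] := countable_int_bij.
have posE : posR = \bigcup_n dyadic_itv (e n) :> set R.
  apply/seteqP; split=> [x|x [n _ /dyadic_itv_sub//]].
  rewrite /posR/= in_itv/= andbT => /dyadic_itv_cover[k xk].
  by have [_ _ /(_ k Logic.I)[n _ nk]] := ebij; exists n => //; rewrite nk.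
rewrite (reindex_esum [set: nat] [set: int] e)// -nneseries_esumT; last first.
  by move=> n; apply: integral_ge0 => x /dyadic_itv_gt0/g0.
rewrite {1}posE (@ge0_integral_bigcup _ (lebesgueR R))//.
- by move=> n; exact: measurable_dyadic.
- by rewrite -posE.
- by move=> x; rewrite -posE /posR/= in_itv/= andbT => /g0.
- apply/trivIsetP => i j _ _ ij; apply/seteqP; split=> // x [/= xi xj].
  have := dyadic_itv_inj xi xj; have [_ inj _] := ebij.
  by move=> /inj; rewrite !inE => /(_ Logic.I Logic.I) /eqP; rewrite (negbTE ij).
Qed.

End dyadic.

(** * The operators *)

Section log_hoelder.
Context {R : realType}.
Local Open Scope ring_scope.

(** On [J_k] the logarithm of [x] has size about [|k|], so [LHoo] serves for [k > 0] and [LH0] for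
    [k < 0]. The last clause holds because [P] jumps only at 0: if [P j] and [P k] differ, then [j]
    and [k] lie on opposite sides of the jump. *)
Lemma log_hoelder_dyadic (p : R -> R) : exponent p -> LH0 p -> LHoo p ->
  exists (L : R) (P : int -> R),
  [/\ forall k, 1 <= P k,
      forall k x, dyadic_itv k x -> `|p x - P k| <= L / `|k|%N.+1%:R &
      forall j k, P j = P k \/ (`|j| <= `|j - k|)%N].
Proof.
move=> [_ p1 [M pM]] [C0 [p0 [C00 p01 H0]]] [Coo [poo [Coo0 poo1 Hoo]]].
have M1 : 1 <= M by have := p1 1 ltr01; have := pM 1 ltr01; lra.
have l2 := @ln2_ge_half R.
(* The summands serve [k < 0] ([4 * C0]), [k > 0] ([4 * Coo]) and [k = 0] ([M + p0]). *)
set B := 4 * C0 + 4 * Coo + M + p0.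
have BE : B = 4 * C0 + 4 * Coo + M + p0 by [].
exists B, (fun k => if 0 < k then poo else p0); split.
- by move=> k; case: ifP.
- move=> k x kx; have x0 := dyadic_itv_gt0 kx.
  have n0 : 0 < `|k|%N.+1%:R :> R by rewrite ltr0n.
  have weaken A A' : A <= A' -> 0 <= A -> A / `|k|%N.+1%:R <= A' / `|k|%N.+1%:R.
    by move=> AB A0; rewrite ler_pM2r ?invr_gt0.
  move: kx; rewrite /dyadic_itv/= in_itv/= => /andP[xl xu].
  case: ltrP => k0.
    apply: le_trans (Hoo _ x0) _; apply: (@le_trans _ _ (4 * Coo / `|k|%N.+1%:R)); last by apply: weaken; lra.
    have e1 : 1 <= ln (expR 1 + x).
      by rewrite -[leLHS]expRK ler_ln ?posrE ?addr_gt0 ?expR_gt0// lerDl ltW.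
    have e2 : (k - 1)%:~R * ln 2 <= ln (expR 1 + x).
      rewrite -ln_exp2z ler_ln ?posrE ?exp2z_gt0 ?addr_gt0 ?expR_gt0//.
      by apply: (le_trans xl); rewrite lerDr expR_ge0.
    have nk : `|k|%N.+1%:R = k%:~R + 1 :> R.
      by rewrite -natr1 natr_absz gtr0_norm.
    have k1 : 1 <= k%:~R :> R by rewrite ler1z; clear -k0; lia.
    move: e2; rewrite intrB => e2.
    rewrite ler_pdivlMr// mulrAC ler_pdivrMr; last lra.
    have kl : (k%:~R - 1) * 2^-1 <= (k%:~R - 1) * ln 2 :> R by rewrite ler_wpM2l//; lra.
    (* Twice the logarithm bounds [k - 1], and the missing 2 is bounded by [e1]. *)
    have h : k%:~R + 1 <= 4 * ln (expR 1 + x) by lra.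
    by rewrite nk [leRHS]mulrAC mulrC ler_pM2r.
  (* [J_0] is [[1/2, 1)], out of reach of [LH0]; there the boundedness of [p] suffices. *)
  have [->|kn0] := eqVneq k 0.
    rewrite divr1; have := p1 _ x0; have := pM _ x0; rewrite ler_norml => a b.
    by apply/andP; split; lra.
  have xh : x < 2^-1.
    apply: (lt_le_trans xu); rewrite -[leRHS]/(2 ^ (-1)) exp2z_le; clear -k0 kn0; lia.
  apply: (le_trans (H0 x _)); first by rewrite x0.
  apply: (@le_trans _ _ (4 * C0 / `|k|%N.+1%:R)); last by apply: weaken; lra.
  have nk : `|k|%N.+1%:R = - k%:~R + 1 :> R.
    by rewrite -natr1 natr_absz ler0_norm// intrN.
  have k1 : k%:~R <= -1 :> R
    by rewrite (_ : -1 = (-1)%:~R)// ler_int; clear -k0 kn0; lia.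
  have e2 : ln x <= k%:~R * ln 2.
    by rewrite -ln_exp2z ler_ln ?posrE ?exp2z_gt0// ltW.
  rewrite ler_pdivlMr// mulrAC ler_pdivrMr; last nra.
  have kl : - k%:~R * 2^-1 <= - k%:~R * ln 2 :> R by rewrite ler_wpM2l//; lra.
  have h : - k%:~R + 1 <= 4 * - ln x by lra.
  by rewrite nk [leRHS]mulrAC mulrC ler_pM2r.
- move=> j k; case: ifPn => j0; case: ifPn => k0; [by left|right|right|by left];
  clear -j0 k0; lia.
Qed.

End log_hoelder.

(** * Comparison of the two operators and their dyadic form *)

Section operators.
Context {R : realType}.

Lemma posRP (x : R) : posR x <-> (0 < x)%R.
Proof. by rewrite /posR/= in_itv/= andbT. Qed.

Lemma measurable_kernel (D : set R) (g : R -> R) (lam : R) :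
  @measurable _ (lebesgueR R) D ->
  @measurable_fun _ _ (measurableTypeR R) (measurableTypeR R) setT g ->
  @measurable_fun _ _ (lebesgueR R) _ D (fun y => ((g y `^ lam)^-1)%R%:E : \bar R).
Proof.
move=> mD mg; apply/measurable_EFinP.
under eq_fun do rewrite -powRN.
apply: measurable_fun_leb => //.
exact: (measurableT_comp (measurable_powR _)).
Qed.

Variables (lam : R) (f : R -> \bar R).
Hypothesis (lam0 : (0 <= lam)%R) (mf : lmeas_fun f).
Hypothesis f0 : forall x, (0 < x)%R -> 0 <= f x.

Let kern0 (y : R) : 0 <= (((y `^ lam)^-1)%R)%:E.
Proof. by rewrite lee_fin invr_ge0 powR_ge0. Qed.

Lemma measurable_fun_kernelM (g : R -> R) :
  @measurable_fun _ _ (measurableTypeR R) (measurableTypeR R) setT g ->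
  @measurable_fun _ _ (lebesgueR R) _ posR (fun y => f y * (((g y) `^ lam)^-1)%:E).
Proof.
move=> mg; apply: emeasurable_funM; first exact: mf.
apply: measurable_kernel; [exact: measurable_posR|exact: mg].
Qed.

(** With a single kernel, [Cop] can be compared pointwise under the integral with [Sop] and with
    dyadic sums. *)
Lemma CopE (x : R) : (0 < x)%R ->
  Cop lam f x = \int[leb]_(y in posR) (f y * (((Num.max x y) `^ lam)^-1)%:E).
Proof.
move=> x0.
have posE : (posR = `]0%R, x[ `|` `[x, +oo[)%classic.
  apply/seteqP; split=> y; rewrite posRP /= !in_itv/= !andbT.
    by move=> y0; case: (ltrP y x) => h; [left; apply/andP|right].
  by move=> [/andP[]//|]; exact: lt_le_trans.
have sub1 : (`]0%R, x[ `<=` posR)%classic by rewrite posE; exact: subsetUl.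
have sub2 : (`[x, +oo[ `<=` posR)%classic by rewrite posE; exact: subsetUr.
have sub3 : (`]x, +oo[ `<=` `[x, +oo[)%classic.
  by move=> y; rewrite /= !in_itv/= !andbT => /ltW.
have mm : measurable_fun setT (fun y : measurableTypeR R => Num.max x y : measurableTypeR R).
  exact: measurable_maxr.
have mk := measurable_fun_kernelM mm.
have k0 y : posR y -> 0 <= f y * (((Num.max x y) `^ lam)^-1)%:E.
  by move=> /posRP y0; apply: mule_ge0; [exact: f0|exact: kern0].
have m1 := @measurable_itv_leb R `]0%R, x[.
have m2 := @measurable_itv_leb R `[x, +oo[.
have E1 : ((x `^ lam)^-1)%:E * \int[leb]_(y in `]0%R, x[%classic) f y =
    \int[leb]_(y in `]0%R, x[%classic) (f y * (((Num.max x y) `^ lam)^-1)%:E).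
  rewrite -leb_integralZl; first last.
  - by move=> y /sub1/posRP/f0.
  - by apply: measurable_funS mf; [exact: measurable_posR|exact: sub1].
  - by rewrite invr_ge0 powR_ge0.
  - exact: m1.
  apply: eq_integral => y; rewrite inE/= in_itv/= => /andP[_ yx].
  by rewrite muleC max_l// ltW.
have E2 : \int[leb]_(y in `]x, +oo[%classic) (f y * ((y `^ lam)^-1)%:E) =
    \int[leb]_(y in `[x, +oo[%classic) (f y * (((Num.max x y) `^ lam)^-1)%:E).
  (* The second integral in [Cop] leaves out the point [x], a null set. *)
  rewrite [RHS](@ge0_negligible_integral _ (lebesgueR R) R leb `[x, +oo[%classic [set x]);
    first last.
  - by rewrite lebE lebesgue_measure_set1.
  - by move=> y /sub2/k0.
  - by apply: measurable_funS mk; [exact: measurable_posR|exact: sub2].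
  - exact: m2.
  - by apply: borel_leb_measurable; exact: measurable_set1.
  have -> : (`[x, +oo[ `\` [set x] = `]x, +oo[)%classic.
    apply/seteqP; split=> y; rewrite /= !in_itv/= !andbT.
      by move=> [xy /eqP yx]; rewrite lt_neqAle eq_sym yx.
    by move=> xy; split; [exact: ltW|apply/eqP; rewrite gt_eqF].
  apply: eq_integral => y; rewrite inE/= in_itv/= andbT => xy.
  by rewrite max_r// ltW.
rewrite /Cop E1 E2 [in RHS]posE.
rewrite (@ge0_integral_setU _ (lebesgueR R) R leb _ _ m1 m2
  (fun y => f y * (((Num.max x y) `^ lam)^-1)%:E)).
- by [].
- by rewrite -posE; exact: mk.
- by move=> y; rewrite -posE; exact: k0.
- apply/disj_setPRL => y /=; rewrite !in_itv/= andbT => xy.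
  by apply/negP; rewrite negb_and -!leNgt xy orbT.
Qed.

Lemma Sop_le_Cop (x : R) : (0 < x)%R -> Sop lam f x <= Cop lam f x.
Proof.
move=> x0; rewrite (CopE x0) /Sop.
apply: (@ge0_le_integral_nonmeas _ (lebesgueR R) R leb posR) => y /posRP y0.
  by apply: mule_ge0 => //; exact: f0.
rewrite lee_wpmul2l ?f0// lee_fin lef_pV2 ?posrE ?powR_gt0 ?addr_gt0//; last first.
  by rewrite lt_max x0.
apply: ge0_ler_powR; rewrite ?nnegrE// ?ge_max ?le_max ?addr_ge0 ?(ltW x0) ?(ltW y0)//.
by rewrite lerDl lerDr !ltW.
Qed.

(** The kernels compare because [x + y] is at most twice the maximum of [x] and [y]. *)
Lemma Cop_le_Sop (x : R) : (0 < x)%R -> Cop lam f x <= (2 `^ lam)%:E * Sop lam f x.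
Proof.
move=> x0; rewrite (CopE x0) /Sop -leb_integralZl; first last.
- by move=> y /posRP y0; apply: mule_ge0; [exact: f0|exact: kern0].
- by apply: measurable_fun_kernelM; exact: measurable_funD.
- exact: powR_ge0.
- exact: measurable_posR.
apply: (@ge0_le_integral_nonmeas _ (lebesgueR R) R leb posR) => y /posRP y0.
  by apply: mule_ge0 => //; exact: f0.
rewrite muleCA lee_wpmul2l ?f0// -EFinM lee_fin -[leLHS]mul1r.
have m0 : (0 < Num.max x y)%R by rewrite lt_max x0.
rewrite ler_pdivrMr ?powR_gt0// mulrAC ler_pdivlMr ?powR_gt0 ?addr_gt0// mul1r.
rewrite -powRM ?(ltW m0)//; apply: ge0_ler_powR; rewrite ?nnegrE ?mulr_ge0 ?addr_ge0 ?(ltW x0) ?(ltW y0) ?(ltW m0)//.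
have : (x <= Num.max x y)%R by rewrite le_max lexx.
have : (y <= Num.max x y)%R by rewrite le_max lexx orbT.
by lra.
Qed.

(** For [x] in [J_j] and [y] in [J_k] the larger of the two is at least half of 2^max(j,k), whence
    the factor 2^lam. *)
Lemma Cop_dyadic (j : int) (x : R) : dyadic_itv j x ->
  Cop lam f x <= \esum_(k in [set: int])
    ((2 `^ lam * ((2 ^ Num.max j k) `^ lam)^-1)%:E * \int[leb]_(y in dyadic_itv k) f y).
Proof.
move=> jx; have x0 := dyadic_itv_gt0 jx.
rewrite (CopE x0) integral_dyadic; first last.
- by move=> y y0; apply: mule_ge0; [exact: f0|exact: kern0].
- by apply: measurable_fun_kernelM; exact: measurable_maxr.
apply: le_esum => k _; rewrite -leb_integralZl; first last.
- by move=> y /dyadic_itv_gt0/f0.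
- apply: measurable_funS mf; [exact: measurable_posR|exact: dyadic_itv_sub].
- by rewrite mulr_ge0 ?invr_ge0 ?powR_ge0.
- exact: measurable_dyadic.
apply: ge0_le_integral_nonmeas => y ky; have y0 := dyadic_itv_gt0 ky.
  by apply: mule_ge0 => //; exact: f0.
rewrite muleC lee_wpmul2r ?f0// lee_fin -[leLHS]mul1r.
have m0 : (0 < Num.max x y)%R by rewrite lt_max x0.
rewrite ler_pdivrMr ?powR_gt0// mulrAC ler_pdivlMr ?powR_gt0 ?exp2z_gt0// mul1r.
rewrite -powRM ?(ltW m0)//; apply: ge0_ler_powR; rewrite ?nnegrE ?mulr_ge0 ?(ltW m0) ?(ltW (exp2z_gt0 _))//.
rewrite (exp2z_pred (Num.max j k)) ler_pM2l//.
move: jx ky; rewrite /dyadic_itv/= !in_itv/= => /andP[jx _] /andP[ky _].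
by rewrite le_max; case: (leP j k) => _; rewrite ?jx ?ky ?orbT.
Qed.

End operators.

(** * Modulars and Luxemburg norms *)

Section modular.
Context {R : realType}.
Implicit Types (r : R -> R) (f g : R -> \bar R) (D : set R).

Lemma lee_poweR (a : R) (x y : \bar R) :
  (0 <= a)%R -> 0 <= x -> x <= y -> x `^ a <= y `^ a.
Proof.
move=> a0 x0 xy; apply: gt0_ler_poweR => //; rewrite in_itv/= leey andbT//.
exact: le_trans xy.
Qed.

(** The integral in [vnorm] at scale [s], for nonnegative [g] and hence without absolute value; the
    set [D] is a parameter because the modular, unlike the norm, is additive in it. *)
Definition modular r D g (s : R) : \bar R :=
  \int[leb]_(x in D) (g x * (s^-1)%:E) `^ (r x).

Lemma modular_ge0 r D g s : 0 <= modular r D g s.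
Proof. by apply: integral_ge0 => x _; exact: poweR_ge0. Qed.

Lemma le_modular_scale r D g (s t : R) : (0 < s <= t)%R ->
  (forall x, D x -> (0 <= r x)%R) -> (forall x, D x -> 0 <= g x) ->
  modular r D g t <= modular r D g s.
Proof.
move=> /andP[s0 st] r0 g0; apply: ge0_le_integral_nonmeas => x Dx.
  exact: poweR_ge0.
apply: lee_poweR; [exact: r0|apply: mule_ge0; first exact: g0|].
  by rewrite lee_fin invr_ge0 (le_trans (ltW s0)).
by rewrite lee_wpmul2l ?g0// lee_fin lef_pV2// posrE (lt_le_trans s0).
Qed.

Lemma vnorm_ge0 r f : 0 <= vnorm r f.
Proof. by apply/ereal_infP => _ [s [s0 _] <-]; rewrite lee_fin ltW. Qed.

Lemma vnorm_le_scale r f (c : R) g : (0 < c)%R ->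
  (forall x, (0 < x)%R -> (0 <= r x)%R) ->
  (forall x, (0 < x)%R -> c%:E * `|g x| <= `|f x|) ->
  c%:E * vnorm r g <= vnorm r f.
Proof.
move=> c0 r0 gf; apply/ereal_infP => _ [s [s0 hs] <-].
rewrite -lee_pdivlMl// -EFinM; apply: ge_ereal_inf.
exists (c^-1 * s)%:E => //; exists (c^-1 * s)%R => //; split.
  by rewrite mulr_gt0// invr_gt0.
apply: le_trans hs; apply: ge0_le_integral_nonmeas => x /posRP x0.
  exact: poweR_ge0.
apply: lee_poweR; first exact: r0.
  by apply: mule_ge0 => //; rewrite lee_fin invr_ge0 mulr_ge0// ?invr_ge0 ltW.
rewrite invfM invrK EFinM muleA.
by rewrite (muleC `|g x|) lee_wpmul2r ?gf// lee_fin invr_ge0 ltW.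
Qed.

Lemma vnorm_le r f g :
  (forall x, (0 < x)%R -> (0 <= r x)%R) ->
  (forall x, (0 < x)%R -> `|g x| <= `|f x|) -> vnorm r g <= vnorm r f.
Proof.
move=> r0 gf; rewrite -[leLHS]mul1e; apply: vnorm_le_scale => // x x0.
by rewrite mul1e gf.
Qed.

Section nonneg.
Variables (r : R -> R) (D : set R) (g : R -> \bar R).
Hypothesis r0 : forall x, (0 < x)%R -> (0 < r x)%R.
Hypothesis g0 : forall x, (0 < x)%R -> 0 <= g x.

Lemma vnorm_le_modular s : (0 < s)%R -> modular r posR g s <= 1 ->
  vnorm r g <= s%:E.
Proof.
move=> s0 hs; apply: ge_ereal_inf; exists s%:E => //; exists s => //; split=> //.
rewrite (_ : (\int[_]_(x in _) _)%E = modular r posR g s)//.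
by apply: eq_integral => x; rewrite inE => /posRP x0; rewrite gee0_abs// g0.
Qed.

(** A strict inequality yields an admissible scale below [s], and the modular decreases as the scale
    grows. *)
Lemma modular_vnorm_lt s : vnorm r g < s%:E ->
  (0 < s)%R /\ modular r posR g s <= 1.
Proof.
move=> /ereal_inf_lt[_ [t [t0 ht] <-]]; rewrite lte_fin => ts.
split; first exact: lt_trans ts.
have tE : (\int[leb]_(x in posR) (`|g x| * (t^-1)%:E) `^ (r x)) = modular r posR g t.
  by apply: eq_integral => x; rewrite inE => /posRP x0; rewrite gee0_abs// g0.
rewrite tE in ht; apply: le_trans ht; apply: le_modular_scale.
- by rewrite t0 ltW.
- by move=> x /posRP/r0/ltW.
- by move=> x /posRP/g0.
Qed.

End nonneg.

Lemma modular_restrict r D g s : D `<=` posR ->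
  (forall x, (0 < x)%R -> (0 < r x)%R) ->
  modular r posR (fun x => g x * (\1_D x)%:E) s = modular r D g s.
Proof.
move=> Dpos r0; rewrite /modular -(setIidr Dpos) integral_mkcondr.
apply: eq_integral => x; rewrite inE => /posRP x0.
rewrite patchE setIidr// indicE; case: ifPn => xD; first by rewrite mule1.
(* Off [D] the integrand is a power of 0, which vanishes because [r x > 0]; with exponent 0 it would
   be 1. *)
by rewrite mule0 mul0e poweR0r// gt_eqF// r0.
Qed.

Lemma vnorm_restrict_le r D g s : D `<=` posR ->
  (forall x, (0 < x)%R -> (0 < r x)%R) -> (forall x, (0 < x)%R -> 0 <= g x) ->
  (0 < s)%R -> modular r D g s <= 1 ->
  vnorm r (fun x => g x * (\1_D x)%:E) <= s%:E.
Proof.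
move=> Dp r0 g0 s0 h; apply: vnorm_le_modular => //; last by rewrite modular_restrict.
by move=> x x0; apply: mule_ge0; rewrite ?g0 ?lee_fin.
Qed.

Lemma modular_restrict_lt r D g s : D `<=` posR ->
  (forall x, (0 < x)%R -> (0 < r x)%R) -> (forall x, (0 < x)%R -> 0 <= g x) ->
  vnorm r (fun x => g x * (\1_D x)%:E) < s%:E ->
  (0 < s)%R /\ modular r D g s <= 1.
Proof.
move=> Dp r0 g0 /modular_vnorm_lt h; rewrite -(modular_restrict _ _ Dp)//.
by apply: h => // x x0; apply: mule_ge0; rewrite ?g0 ?lee_fin.
Qed.

Lemma measurable_modular r D g (s : R) :
  @measurable _ (lebesgueR R) D -> D `<=` posR -> lmeas_fun r -> lmeas_fun g ->
  @measurable_fun _ _ (lebesgueR R) _ D (fun x => (g x * (s^-1)%:E) `^ (r x)).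
Proof.
move=> mD Dp mr mg; apply: measurable_fun_poweR; first exact: mD.
- apply: emeasurable_funM; last exact: measurable_cst.
  by apply: measurable_funS mg; [exact: measurable_posR|exact: Dp].
- by apply: measurable_funS mr; [exact: measurable_posR|exact: Dp].
Qed.

Lemma modular_setU r (D D' : set R) g s :
  @measurable _ (lebesgueR R) D -> @measurable _ (lebesgueR R) D' ->
  D `<=` posR -> D' `<=` posR -> [disjoint D & D'] ->
  lmeas_fun r -> lmeas_fun g ->
  modular r (D `|` D') g s = modular r D g s + modular r D' g s.
Proof.
move=> mD mD' Dp Dp' DD mr mg.
apply: (@ge0_integral_setU _ (lebesgueR R) R leb _ _ mD mD').
- apply: measurable_modular; [exact: measurableU| |exact: mr|exact: mg].
  by rewrite subUset.
- by move=> x _; exact: poweR_ge0.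
- exact: DD.
Qed.

Lemma le_modular_subset r (D D' : set R) g s :
  @measurable _ (lebesgueR R) D -> @measurable _ (lebesgueR R) D' ->
  D `<=` D' -> D' `<=` posR -> lmeas_fun r -> lmeas_fun g ->
  modular r D g s <= modular r D' g s.
Proof.
move=> mD mD' DD Dp mr mg; apply: (@ge0_subset_integral _ (lebesgueR R) R leb _ _ mD mD').
- exact: measurable_modular.
- by move=> x _; exact: poweR_ge0.
- exact: DD.
Qed.

(** Bounded exponents: each integrand gains the factor (1/c)^r(x), at most (1/c)^M. *)
Lemma modular_shrink r D g (s c M : R) : @measurable _ (lebesgueR R) D ->
  D `<=` posR -> lmeas_fun r -> lmeas_fun g -> (0 < s)%R -> (0 < c <= 1)%R ->
  (forall x, (0 < x)%R -> 0 <= g x) ->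
  (forall x, (0 < x)%R -> (0 <= r x <= M)%R) ->
  modular r D g (c * s) <= ((c^-1) `^ M)%:E * modular r D g s.
Proof.
move=> mD Dp mr mg s0 /andP[c0 c1] g0 rM.
rewrite -leb_integralZl; first last.
- by move=> x _; exact: poweR_ge0.
- exact: measurable_modular.
- exact: powR_ge0.
- exact: mD.
apply: ge0_le_integral_nonmeas => x /Dp/posRP x0; first exact: poweR_ge0.
have ic : 0 <= (c^-1)%:E :> \bar R by rewrite lee_fin invr_ge0 ltW.
have is0 : 0 <= (s^-1)%:E :> \bar R by rewrite lee_fin invr_ge0 ltW.
rewrite invfM EFinM muleCA [leLHS]poweRM//; last by apply: mule_ge0 => //; exact: g0.
rewrite poweR_EFin lee_wpmul2r ?poweR_ge0// lee_fin ler_powR//; last by have /andP[] := rM _ x0.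
by rewrite invf_ge1.
Qed.

End modular.

(** * Reverse doubling *)

Section positivity.
Context {R : realType}.

Lemma lee_1D_poweR (a : R) (x : \bar R) : (1 <= a)%R -> 0 <= x -> x <= 1 + x `^ a.
Proof.
move=> a1; have a0 : (a == 0)%R = false by rewrite gt_eqF//; lra.
case: x => [x||]//=; last by rewrite a0 leey.
rewrite !lee_fin => x0; have [x1|x1] := leP x 1%R.
  by rewrite (le_trans x1)// lerDl powR_ge0.
by rewrite (le_trans (le1r_powR (ltW x1) a1))// lerDr.
Qed.

(** If the norm were 0, the modular would be at most 1 at every scale [s]; integrating g <= s (1 +
    (g/s)^r) over [D] then bounds the integral of [g] by s (|D| + 1) for all [s], so [g] would
    vanish a.e. on [D]. *)
Lemma vnorm_restrict_gt0 (r : R -> R) (g : R -> \bar R) (D : set R) :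
  @measurable _ (lebesgueR R) D -> D `<=` posR -> 0 < leb D < +oo ->
  lmeas_fun r -> lmeas_fun g -> (forall x, (0 < x)%R -> (1 <= r x)%R) ->
  (forall x, (0 < x)%R -> 0 <= g x) ->
  {ae leb, forall x : lebesgueR R, (0 < x :> R)%R -> 0 < g x} ->
  0 < vnorm r (fun x => g x * (\1_D x)%:E).
Proof.
move=> mD Dp /andP[D0 Doo] mr mg r1 g0 gpos.
rewrite lt_neqAle vnorm_ge0 andbT eq_sym; apply/negP => /eqP v0.
have r0 x : (0 < x)%R -> (0 < r x)%R by move=> /r1; lra.
have Dfin : leb D = (fine (leb D))%:E by rewrite fineK// ge0_fin_numE.
have le_s (s : R) : (0 < s)%R -> \int[leb]_(x in D) g x <= s%:E * (leb D + 1).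
  move=> s0; have [_ hs] : (0 < s)%R /\ modular r D g s <= 1.
    by apply: modular_restrict_lt => //; rewrite v0 lte_fin.
  have mm := measurable_modular s mD Dp mr mg.
  have m0 := modular_ge0 r D g s.
  have mg' : @measurable_fun _ _ (lebesgueR R) _ D g.
    apply: measurable_funS mg; [exact: measurable_posR|exact: Dp].
  apply: (@le_trans _ _ (s%:E * \int[leb]_(x in D) cst 1 x + s%:E * modular r D g s)).
    apply: (@ae_ge0_le_integral_lincomb _ (lebesgueR R)).
    - exact: mD.
    - exact: ltW.
    - exact: ltW.
    - exact: mg'.
    - exact: measurable_cst.
    - exact: mm.
    - by move=> x /Dp/posRP/g0.
    - by [].
    - by move=> x _; exact: poweR_ge0.
    apply: aeW => x /Dp/posRP x0.
    have p0 := poweR_ge0 (g x * (s^-1)%:E) (r x).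
    rewrite /= -ge0_muleDr// muleC -lee_pdivrMr//; apply: lee_1D_poweR; first exact: r1.
    by apply: mule_ge0; [exact: g0|rewrite lee_fin invr_ge0 ltW].
  rewrite integral_cst; last exact: mD.
  rewrite mul1e -ge0_muleDr//.
  apply: lee_wpmul2l; first by rewrite lee_fin ltW.
  exact: leeD2l.
have int0 : \int[leb]_(x in D) g x = 0.
  apply/eqP; rewrite eq_le; apply/andP; split; last first.
    by apply: integral_ge0 => x /Dp/posRP/g0.
  apply/lee_addgt0Pr => e e0; rewrite add0e.
  have lD0 : (0 < fine (leb D) + 1 :> R)%R by rewrite ltr_wpDl// fine_ge0// ltW.
  have := le_s (e / (fine (leb D) + 1))%R; rewrite divr_gt0// => /(_ isT).
  by rewrite Dfin -EFinD -EFinM divfK// gt_eqF.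
have aeg : ae_eq leb (D : set (lebesgueR R)) g (cst 0).
  apply/(ae_eq_integral_abs _ mD).
    by apply: measurable_funS mg => //; exact: measurable_posR.
  rewrite -[RHS]int0; apply: eq_integral => x; rewrite inE => /Dp/posRP x0.
  by rewrite gee0_abs// g0.
have : leb D = 0.
  have nD : {ae leb, forall x : lebesgueR R, ~ D x}.
    apply: filterS2 aeg gpos => x gx0 gx Dx; have /posRP x0 := Dp _ Dx.
    by have := gx x0; rewrite gx0// ltxx.
  apply: (measure_negligible mD); apply: negligibleS nD => x Dx.
  by rewrite /=; exact.
by move=> D00; rewrite D00 ltxx in D0.
Qed.

End positivity.

(** * Reciprocal weights with exponents satisfying [1/a + 1/b = lam] *)

Section dual_pair.
Context {R : realType}.
Local Open Scope ring_scope.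

(** Young's inequality for X^(1/lam) and Y^(1/lam) with the conjugate exponents [lam * a] and
    [lam * b]; its coefficients are at most 1 and are dropped. *)
Lemma young_sum (lam a b X Y : R) : 0 < lam -> 0 < a -> 0 < b ->
  a^-1 + b^-1 = lam -> 0 <= X -> 0 <= Y ->
  (X * Y) `^ (lam^-1) <= X `^ a + Y `^ b.
Proof.
move=> l0 a0 b0 ab X0 Y0.
have la0 : 0 < lam * a by rewrite mulr_gt0.
have lb0 : 0 < lam * b by rewrite mulr_gt0.
have h : (lam * a)^-1 + (lam * b)^-1 = 1.
  by rewrite !invfM -mulrDr ab mulVf// gt_eqF.
rewrite powRM//.
have := conjugate_powR (powR_ge0 X lam^-1) (powR_ge0 Y lam^-1) la0 lb0 h.
rewrite -!powRrM !mulrA mulVf ?gt_eqF// !mul1r => /le_trans; apply.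
have ia0 : 0 < (lam * a)^-1 by rewrite invr_gt0.
have ib0 : 0 < (lam * b)^-1 by rewrite invr_gt0.
by apply: lerD; rewrite ler_piMr ?powR_ge0//; lra.
Qed.

Variables (lam M : R) (a b : R -> R) (u v : R -> \bar R).
Hypothesis lam0 : 0 < lam.
Hypothesis a_bnd : forall x, 0 < x -> 1 <= a x <= M.
Hypothesis b_bnd : forall x, 0 < x -> 1 <= b x <= M.
Hypothesis abE : forall x, 0 < x -> (a x)^-1 + (b x)^-1 = lam.
Hypotheses (ma : lmeas_fun a) (mb : lmeas_fun b).
Hypotheses (mu : lmeas_fun u) (mv : lmeas_fun v).
Hypothesis u0 : forall x, 0 < x -> (0 <= u x)%E.
Hypothesis uv : {ae leb, forall x : lebesgueR R, 0 < (x : R) ->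
  exists2 y : R, 0 < y & u x = y%:E /\ v x = y^-1%:E}.

Let a_gt0 x : 0 < x -> 0 < a x.
Proof. by move=> /a_bnd /andP[]; lra. Qed.
Let b_gt0 x : 0 < x -> 0 < b x.
Proof. by move=> /b_bnd /andP[]; lra. Qed.

Definition dyadic_ball (k : int) : set R := `]0, (2 : R) ^ k[%classic.

Lemma dyadic_ball_sub k : dyadic_ball k `<=` posR.
Proof. by move=> x; rewrite /dyadic_ball posRP /= in_itv/= => /andP[]. Qed.

Lemma measurable_dyadic_ball k : @measurable _ (lebesgueR R) (dyadic_ball k).
Proof. exact: measurable_itv_leb. Qed.

Lemma dyadic_ball_split k :
  dyadic_ball k = (dyadic_ball (k - 1) `|` dyadic_itv k)%classic.
Proof.
have e0 : 0 < (2 : R) ^ (k - 1) by exact: exp2z_gt0.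
apply/seteqP; split=> x; rewrite /dyadic_ball /dyadic_itv /= !in_itv/=.
  by move=> /andP[-> xk]; rewrite xk andbT; case: ltP => h; [left|right].
rewrite (exp2z_pred k).
by move=> [/andP[x0 xk]|/andP[xk xk']]; apply/andP; split => //; lra.
Qed.

Lemma dyadic_ball_disj k : [disjoint (dyadic_ball (k - 1)) & (dyadic_itv k)]%classic.
Proof.
apply/disj_setPRL => x; rewrite /dyadic_ball /dyadic_itv /= !in_itv/=.
by move=> /andP[xk _]; apply/negP; rewrite negb_and -!leNgt xk orbT.
Qed.

Lemma dyadic_itv_ball k : dyadic_itv k `<=` dyadic_ball k.
Proof. by rewrite dyadic_ball_split; exact: subsetUr. Qed.

(* Hölder's inequality [|J| <= C (|u|_a |v|_b)^(1/lam)] on [J = dyadic_itv k] keeps a fixed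
   proportion of the modular of [u] on [J]; the rest is what is left for the smaller ball. *)
Lemma modular_reverse_doubling (A : R) : 1 <= A ->
  exists2 th : R, 0 < th < 1 & forall (k : int) (s r : R), 0 < s -> 0 < r ->
  (s * r) `^ (lam^-1) <= A * 2 ^ (k - 1) ->
  (modular a (dyadic_ball k) u s <= 1)%E ->
  (modular b (dyadic_ball k) v r <= 1)%E ->
  (modular a (dyadic_ball (k - 1)) u (th * s) <= 1)%E.
Proof.
move=> A1.
have M1 : 1 <= M by have /andP[] := a_bnd ltr01; lra.
(* With this [T] the contribution of [v] to the estimate below is at most [A / T = 1/2]. *)
pose T := 2 * A; have T1 : 1 <= T by rewrite /T; lra.
have T0 : 0 < T by lra.
have TM1 : 1 <= T `^ M by rewrite (le_trans T1)// le1r_powR.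
pose de := (2 * (A * T `^ M))^-1.
have de1 : 0 < de <= 2^-1.
  have ATM : 1 <= A * T `^ M by nra.
  rewrite /de; move: ATM; set X := A * _ => X1.
  by rewrite invr_gt0 lef_pV2 ?posrE; [apply/andP; split; lra|lra|lra].
(* Shrinking the scale by this factor multiplies the modular by at most [1 / (1 - de)]. *)
exists ((1 - de) `^ M^-1).
  apply/andP; split; first by rewrite powR_gt0//; lra.
  rewrite -[ltRHS](congr1 (fun h => h M^-1) (@powR1 R)).
  by apply: gt0_ltr_powR; rewrite ?invr_gt0 ?nnegrE//; lra.
move=> k s r s0 r0 sr hu hv.
set th := _ `^ _.
have th01 : 0 < th <= 1.
  rewrite powR_gt0/=; last lra.
  rewrite -[leRHS](congr1 (fun h => h M^-1) (@powR1 R)).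
  by apply: ge0_ler_powR; rewrite ?invr_ge0 ?nnegrE//; lra.
pose J : set R := dyadic_itv k; pose S := modular a J u s; pose S' := modular b J v r.
have mJ : @measurable _ (lebesgueR R) J by exact: measurable_dyadic.
have Jp : J `<=` posR by exact: dyadic_itv_sub.
have split_u : modular a (dyadic_ball k) u s =
    (modular a (dyadic_ball (k - 1)) u s + S)%E.
  rewrite {1}dyadic_ball_split modular_setU //; last exact: dyadic_ball_disj.
  - exact: measurable_dyadic_ball.
  - exact: dyadic_ball_sub.
have S1 : (S <= 1)%E.
  by apply: le_trans hu; rewrite split_u leeDr// modular_ge0.
have S'1 : (S' <= 1)%E.
  apply: le_trans hv; apply: le_modular_subset => //.
  - exact: measurable_dyadic_ball.
  - exact: dyadic_itv_ball.
  - exact: dyadic_ball_sub.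
have S0 : (0 <= S)%E by exact: modular_ge0.
have Sfin : S = (fine S)%:E.
  by rewrite fineK// ge0_fin_numE// (le_lt_trans S1)// ltry.
have muJ := measurable_modular s mJ Jp ma mu.
have mvJ := measurable_modular r mJ Jp mb mv.
pose B := (s * r) `^ lam^-1.
have B0 : 0 < B by rewrite powR_gt0// mulr_gt0.
have cu0 x : (0 <= (T `^ M)%:E * (u x * s^-1%:E) `^ a x)%E.
  by rewrite mule_ge0 ?poweR_ge0// lee_fin powR_ge0.
have cv0 x : (0 <= (T ^-1)%:E * (v x * r^-1%:E) `^ b x)%E.
  by rewrite mule_ge0 ?poweR_ge0// lee_fin invr_ge0 ltW.
have key : (leb J <= B%:E * ((T `^ M)%:E * S + T^-1%:E * S'))%E.
  have BT0 : 0 <= B * T `^ M by rewrite mulr_ge0 ?powR_ge0// ltW.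
  have Bi0 : 0 <= B / T by rewrite divr_ge0 ?ltW.
  rewrite ge0_muleDr ?mule_ge0 ?lee_fin ?powR_ge0 ?invr_ge0 ?modular_ge0 ?(ltW T0)//.
  rewrite !muleA -!EFinM -[leLHS]mul1e -(integral_cst _ mJ).
  apply: (@ae_ge0_le_integral_lincomb _ (lebesgueR R)).
  - exact: mJ.
  - exact: BT0.
  - exact: Bi0.
  - exact: measurable_cst.
  - exact: muJ.
  - exact: mvJ.
  - by [].
  - by move=> x _; exact: poweR_ge0.
  - by move=> x _; exact: poweR_ge0.
  (* Young's inequality for [T * (y / s)] and [T^-1 * (y^-1 / r)], whose product [1 / (s r)] does
     not depend on [x]. Then T^a <= T^M and T^(-b) <= 1/T remove the variable exponents of [T]. *)
  apply: filterS uv => x + /Jp/posRP x0 => /(_ x0)[y y0 [-> ->]] /=.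
  rewrite -!EFinM -!EFinD lee_fin -!mulrA -mulrDr.
  have /andP[ax1 axM] := a_bnd x0; have /andP[bx1 bxM] := b_bnd x0.
  have := @young_sum lam (a x) (b x) (T * (y / s)) (T^-1 * (y^-1 / r))
    lam0 (a_gt0 x0) (b_gt0 x0) (abE x0).
  have ys0 : 0 <= y / s by rewrite divr_ge0// ltW.
  have yr0 : 0 <= y^-1 / r by rewrite divr_ge0 ?invr_ge0// ltW.
  have Ti0 : 0 < T^-1 by rewrite invr_gt0.
  have -> : T * (y / s) * (T^-1 * (y^-1 / r)) = (s * r)^-1.
    by field; rewrite ?gt_eqF.
  move=> /(_ (mulr_ge0 (ltW T0) ys0) (mulr_ge0 (ltW Ti0) yr0)).
  have -> : (s * r)^-1 `^ lam^-1 = B^-1.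
    have sr0 : 0 < s * r by rewrite mulr_gt0.
    rewrite -[(s * r)^-1]powR_inv1 ?ltW// powRAC powR_inv1//.
    exact: powR_ge0.
  rewrite (powRM _ (ltW T0) ys0) (powRM _ (ltW Ti0) yr0) => h.
  rewrite mulrC -ler_pdivrMr// mul1r; apply: (le_trans h); apply: lerD.
    by rewrite ler_wpM2r ?powR_ge0//; exact: ler_powR.
  rewrite ler_wpM2r ?powR_ge0//; apply: ge1r_powR => //.
  by rewrite Ti0 invf_le1.
(* Dividing [key] by |J| = 2^(k-1) and using B <= A |J| gives 1 <= A T^M S + 1/2. *)
have deS : de <= fine S.
  have e0 : 0 < (2 : R) ^ (k - 1) by exact: exp2z_gt0.
  have : ((2 : R) ^ (k - 1) <= B * (T `^ M * fine S + T^-1))%R.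
    rewrite -lee_fin -leb_dyadic EFinM EFinD EFinM -Sfin.
    apply: (le_trans key); rewrite lee_wpmul2l ?lee_fin ?(ltW B0)// leeD2l//.
    by rewrite -[leRHS]mule1 lee_wpmul2l// lee_fin invr_ge0 ltW.
  have fS0 : 0 <= fine S by rewrite fine_ge0.
  have F0 : 0 <= T `^ M * fine S + T^-1.
    by rewrite addr_ge0 ?mulr_ge0 ?powR_ge0// invr_ge0 ltW.
  move=> /le_trans/(_ (ler_wpM2r F0 sr)).
  rewrite mulrAC -{1}[2 ^ (k - 1)]mul1r ler_pM2r// => h.
  rewrite /de -[leLHS]mul1r ler_pdivrMr; last by nra.
  have AT : A * T^-1 = 2^-1 by rewrite /T; field; lra.
  move: h; rewrite mulrDr AT; lra.
have hball : (modular a (dyadic_ball (k - 1)) u s <= (1 - de)%:E)%E.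
  rewrite EFinB leeBrDr//; apply: le_trans hu; rewrite split_u leeD2l//.
  by rewrite Sfin lee_fin.
apply: (le_trans (modular_shrink (M := M) _ _ ma mu s0 th01 u0 _)).
- exact: measurable_dyadic_ball.
- exact: dyadic_ball_sub.
- by move=> x /a_bnd /andP[? ->]; rewrite andbT; lra.
have de2 : 0 < 1 - de by lra.
have -> : th^-1 `^ M = (1 - de)^-1.
  rewrite -[th^-1]powR_inv1 ?powR_ge0// powRAC /th -(powRrM _ M^-1 M).
  rewrite (mulVf (lt0r_neq0 (lt_le_trans ltr01 M1))).
  by rewrite powRr1 ?powR_inv1// ltW.
apply: (le_trans (lee_wpmul2l _ hball)); first by rewrite lee_fin invr_ge0 ltW.
by rewrite -EFinM mulVf// gt_eqF.
Qed.

End dual_pair.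

(** * Geometric decay of the norms over shrinking intervals *)

Section norm_decay.
Context {R : realType}.
Local Open Scope ring_scope.

Definition dual_weights (u v : R -> \bar R) := {ae leb, forall x : lebesgueR R,
  0 < (x : R) -> exists2 y : R, 0 < y & u x = y%:E /\ v x = y^-1%:E}.

Definition ball_norm (r : R -> R) (g : R -> \bar R) (k : int) : \bar R :=
  vnorm r (fun x => (g x * (\1_(@dyadic_ball R k) x)%:E)%E).

Variables (lam M C : R) (a b : R -> R) (u v : R -> \bar R).
Hypothesis lam0 : 0 < lam.
Hypothesis a_bnd : forall x, 0 < x -> 1 <= a x <= M.
Hypothesis b_bnd : forall x, 0 < x -> 1 <= b x <= M.
Hypothesis abE : forall x, 0 < x -> (a x)^-1 + (b x)^-1 = lam.
Hypotheses (ma : lmeas_fun a) (mb : lmeas_fun b).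
Hypotheses (mu : lmeas_fun u) (mv : lmeas_fun v).
Hypothesis u0 : forall x, 0 < x -> (0 <= u x)%E.
Hypothesis v0 : forall x, 0 < x -> (0 <= v x)%E.
Hypothesis uv : dual_weights u v.
Hypothesis uvC : forall k, (ball_norm a u k * ball_norm b v k <= (C * (2 ^ k) `^ lam)%:E)%E.

Let a_gt0 x : 0 < x -> 0 < a x.
Proof. by move=> /a_bnd /andP[]; lra. Qed.
Let b_gt0 x : 0 < x -> 0 < b x.
Proof. by move=> /b_bnd /andP[]; lra. Qed.

Let leb_ball k : (0 < leb (@dyadic_ball R k) < +oo)%E.
Proof.
rewrite lebE lebesgue_measure_itv/= lte_fin exp2z_gt0 -EFinB subr0 lte_fin exp2z_gt0.
by rewrite ltry.
Qed.

Let pu k : (0 < ball_norm a u k)%E.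
Proof.
apply: vnorm_restrict_gt0 => //.
- exact: measurable_dyadic_ball.
- exact: dyadic_ball_sub.
- by move=> x /a_bnd/andP[].
- by apply: filterS uv => x + x0 => /(_ x0)[y y0 [-> _]].
Qed.

Let pv k : (0 < ball_norm b v k)%E.
Proof.
apply: vnorm_restrict_gt0 => //.
- exact: measurable_dyadic_ball.
- exact: dyadic_ball_sub.
- by move=> x /b_bnd/andP[].
- by apply: filterS uv => x + x0 => /(_ x0)[y y0 [_ ->]]; rewrite lte_fin invr_gt0.
Qed.

(** Both norms are positive and their product is finite, so neither is infinite. *)
Lemma ball_norm_fin k : exists2 d : R, 0 < d & ball_norm a u k = d%:E.
Proof.
have := pu k; have := uvC k; have := pv k.
case: (ball_norm a u k) => [d||]// pvk.
  by rewrite lte_fin => _ d0; exists d.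
by rewrite gt0_mulye// leye_eq.
Qed.

(** Reverse doubling at scales decreasing to the norm of [u]; a modular is known to be at most 1
    only strictly above the norm. *)
Lemma ball_norm_decay : exists2 th : R, 0 < th < 1 & forall k,
  (ball_norm a u (k - 1) <= th%:E * ball_norm a u k)%E.
Proof.
(* The scales below satisfy s r <= 4 d e <= 4 C 2^(k lam); the 1/lam-th power of this is
   (4C)^(1/lam) 2^k, and 2^k is twice 2^(k-1). *)
pose A := Num.max 1 (2 * (4 * C) `^ lam^-1).
have A1 : 1 <= A by rewrite le_max lexx.
have [th th01 H] := modular_reverse_doubling lam0 a_bnd b_bnd abE ma mb mu mv u0 uv A1.
have [th0 th1] := andP th01.
exists th => // k.
have [d d0 dE] := ball_norm_fin k; have [d' d'0 d'E] := ball_norm_fin (k - 1).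
have ek : exists2 e : R, 0 < e & ball_norm b v k = e%:E.
  have := uvC k; have := pv k; rewrite dE.
  case: (ball_norm b v k) => [e||]//; first by exists e.
  by move=> _; rewrite gt0_muley ?lte_fin// leye_eq.
have [e e0 eE] := ek.
have deC : d * e <= C * (2 ^ k) `^ lam by have := uvC k; rewrite dE eE -EFinM lee_fin.
rewrite d'E dE -EFinM lee_fin.
have step s : d < s -> s < 2 * d -> d' <= th * s.
  move=> ds s2d; have s0 : 0 < s by lra.
  rewrite -lee_fin -d'E; apply: vnorm_restrict_le => //.
  - exact: dyadic_ball_sub.
  - by rewrite mulr_gt0.
  apply: (H k s (2 * e)) => //; first by rewrite mulr_gt0.
  - have p0 : 0 < (2 : R) ^ k by exact: exp2z_gt0.
    have C0 : 0 < C by rewrite -(pmulr_lgt0 _ (powR_gt0 lam p0)) (lt_le_trans _ deC)// mulr_gt0.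
    apply: (@le_trans _ _ ((4 * C * (2 ^ k) `^ lam) `^ lam^-1)).
      apply: ge0_ler_powR; rewrite ?nnegrE ?invr_ge0 ?mulr_ge0 ?powR_ge0 ?(ltW lam0) ?(ltW C0) ?(ltW s0) ?(ltW e0)//; nra.
    rewrite powRM ?powR_ge0 ?mulr_ge0 ?(ltW C0)// -powRrM mulfV ?gt_eqF// powRr1 ?(ltW p0)//.
    rewrite (exp2z_pred k) mulrCA mulrA ler_pM2r ?exp2z_gt0//.
    by rewrite /A le_max lexx orbT.
  - have h : (ball_norm a u k < s%:E)%E by rewrite dE lte_fin.
    by have [] := modular_restrict_lt (dyadic_ball_sub (k:=k)) a_gt0 u0 h.
  - have h : (ball_norm b v k < (2 * e)%:E)%E by rewrite eE lte_fin; lra.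
    by have [] := modular_restrict_lt (dyadic_ball_sub (k:=k)) b_gt0 v0 h.
(* Otherwise [d < d' / th], and [step] at the midpoint of [d] and [m] contradicts [m <= d' / th]. *)
rewrite leNgt; apply/negP => h.
have dx : d < d' / th by rewrite ltr_pdivlMr// mulrC.
pose m := Num.min (d' / th) (2 * d).
have m1 : d < m by rewrite lt_min dx; lra.
have m2 : m <= d' / th by rewrite ge_min lexx.
have m3 : m <= 2 * d by rewrite ge_min lexx orbT.
have := step ((d + m) / 2); have -> : d < (d + m) / 2 by lra.
have -> : (d + m) / 2 < 2 * d by lra.
move=> /(_ isT isT); rewrite mulrC -ler_pdivrMr//; lra.
Qed.

Lemma ball_norm_decay_iter (th : R) : 0 < th ->
  (forall k, (ball_norm a u (k - 1) <= th%:E * ball_norm a u k)%E) ->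
  forall j k : int, j <= k -> (ball_norm a u j <= (th ^+ `|j - k|)%:E * ball_norm a u k)%E.
Proof.
move=> th0 H j k jk.
have [n ->] : exists n : nat, j = k - n%:Z by exists (absz (k - j)%R); clear -jk; lia.
have -> : absz (k - n%:Z - k)%R = n by clear; lia.
elim: n => [|n ih]; first by rewrite subr0 expr0 mul1e.
have -> : k - n.+1%:Z = k - n%:Z - 1 by clear; lia.
by apply: (le_trans (H _)); rewrite exprS EFinM -muleA lee_wpmul2l// lee_fin ltW.
Qed.

End norm_decay.

Section dyadic_weights.
Context {R : realType}.
Local Open Scope ring_scope.

Lemma dual_weights_sym (u v : R -> \bar R) : dual_weights u v -> dual_weights v u.
Proof.
apply: filterS => x + x0 => /(_ x0)[y y0 [-> ->]].
by exists y^-1; rewrite ?invr_gt0 ?invrK.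
Qed.

(** For [j <= k] the norm of [u] decays from [k] down to [j]; for [j > k] the norm of [v] decays
    from [j] down to [k]. In either case the product is compared with the hypothesis at the larger
    index. *)
Lemma dyadic_weights (lam M C : R) (a b : R -> R) (u v : R -> \bar R) :
  0 < lam -> (forall x, 0 < x -> 1 <= a x <= M) ->
  (forall x, 0 < x -> 1 <= b x <= M) ->
  (forall x, 0 < x -> (a x)^-1 + (b x)^-1 = lam) ->
  lmeas_fun a -> lmeas_fun b -> lmeas_fun u -> lmeas_fun v ->
  (forall x, 0 < x -> (0 <= u x)%E) -> (forall x, 0 < x -> (0 <= v x)%E) ->
  dual_weights u v -> 0 < C ->
  (forall k, (ball_norm a u k * ball_norm b v k <= (C * (2 ^ k) `^ lam)%:E)%E) ->
  exists (rho B : R) (al be : int -> R),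
  [/\ 0 < rho < 1, 0 < B, forall k, 0 < al k /\ 0 < be k,
      forall k, (modular a (dyadic_itv k) u (al k) <= 1)%E /\
                (modular b (dyadic_itv k) v (be k) <= 1)%E &
      forall j k, al j * be k <= B * rho ^+ `|j - k| * (2 ^ Num.max j k) `^ lam].
Proof.
move=> lam0 abd bbd abE ma mb mu mv u0 v0 uv C0 uvC.
have baE x : 0 < x -> (b x)^-1 + (a x)^-1 = lam by rewrite addrC; exact: abE.
have vu := dual_weights_sym uv.
have vuC k : (ball_norm b v k * ball_norm a u k <= (C * (2 ^ k) `^ lam)%:E)%E.
  by rewrite muleC.
have fu := ball_norm_fin abd bbd ma mb mu mv u0 v0 uv uvC.
have fv := ball_norm_fin bbd abd mb ma mv mu v0 u0 vu vuC.
have [t1 /andP[t10 t11] H1] := ball_norm_decay lam0 abd bbd abE ma mb mu mv u0 v0 uv uvC.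
have [t2 /andP[t20 t21] H2] := ball_norm_decay lam0 bbd abd baE mb ma mv mu v0 u0 vu vuC.
pose d k := fine (ball_norm a u k); pose e k := fine (ball_norm b v k).
have dE k : ball_norm a u k = (d k)%:E by rewrite /d; have [z _ ->] := fu k.
have eE k : ball_norm b v k = (e k)%:E by rewrite /e; have [z _ ->] := fv k.
have d0 k : 0 < d k by rewrite /d; have [z ? ->] := fu k.
have e0 k : 0 < e k by rewrite /e; have [z ? ->] := fv k.
have deC k : d k * e k <= C * (2 ^ k) `^ lam.
  by have := uvC k; rewrite dE eE -EFinM lee_fin.
pose rho := Num.max t1 t2.
have t1r : t1 <= rho by rewrite le_max lexx.
have t2r : t2 <= rho by rewrite le_max lexx orbT.
have rho0 : 0 < rho by lra.
have rho1 : rho < 1 by rewrite gt_max t11.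
have dj (j k : int) : j <= k -> d j <= rho ^+ `|j - k| * d k.
  move=> jk; have := ball_norm_decay_iter t10 H1 jk.
  rewrite !dE -EFinM lee_fin => /le_trans; apply.
  by rewrite ler_wpM2r ?(ltW (d0 k))// lerXn2r ?nnegrE ?(ltW rho0) ?(ltW t10).
have ej (j k : int) : j <= k -> e j <= rho ^+ `|j - k| * e k.
  move=> jk; have := ball_norm_decay_iter t20 H2 jk.
  rewrite !eE -EFinM lee_fin => /le_trans; apply.
  by rewrite ler_wpM2r ?(ltW (e0 k))// lerXn2r ?nnegrE ?(ltW rho0) ?(ltW t20).
(* Doubling puts the scales strictly above the norms over the whole intervals (0, 2^k), which
   contain [J_k]; the two factors 2 turn [C] into [4 * C]. *)
exists rho, (4 * C), (fun k => 2 * d k), (fun k => 2 * e k); split.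
- by rewrite rho0.
- by rewrite mulr_gt0.
- by move=> k; rewrite !mulr_gt0.
- move=> k; split.
    apply: (@le_trans _ _ (modular a (dyadic_ball k) u (2 * d k))).
      apply: le_modular_subset; [exact: measurable_dyadic|exact: measurable_dyadic_ball|
        exact: dyadic_itv_ball|exact: dyadic_ball_sub|exact: ma|exact: mu].
    have h : (ball_norm a u k < (2 * d k)%:E)%E by rewrite dE lte_fin; have := d0 k; lra.
    have a0 x : 0 < x -> 0 < a x by move=> /abd/andP[]; lra.
    by have [] := modular_restrict_lt (dyadic_ball_sub (k:=k)) a0 u0 h.
  apply: (@le_trans _ _ (modular b (dyadic_ball k) v (2 * e k))).
    apply: le_modular_subset; [exact: measurable_dyadic|exact: measurable_dyadic_ball|
      exact: dyadic_itv_ball|exact: dyadic_ball_sub|exact: mb|exact: mv].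
  have h : (ball_norm b v k < (2 * e k)%:E)%E by rewrite eE lte_fin; have := e0 k; lra.
  have b0 x : 0 < x -> 0 < b x by move=> /bbd/andP[]; lra.
  by have [] := modular_restrict_lt (dyadic_ball_sub (k:=k)) b0 v0 h.
- move=> j k; have r0 n : 0 <= rho ^+ n by rewrite exprn_ge0// ltW.
  case: (leP j k) => jk.
    have h := ler_pM (ltW (d0 j)) (ltW (e0 k)) (dj _ _ jk) (lexx _).
    have h2 := ler_wpM2l (r0 `|j - k|%N) (deC k).
    have -> : 2 * d j * (2 * e k) = 4 * (d j * e k) by ring.
    have -> : 4 * C * rho ^+ `|j - k| * (2 ^ k) `^ lam =
      4 * (rho ^+ `|j - k| * (C * (2 ^ k) `^ lam)) by ring.
    by rewrite ler_pM2l//; apply: (le_trans h); rewrite -mulrA.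
  have h := ler_pM (ltW (d0 j)) (ltW (e0 k)) (lexx _) (ej _ _ (ltW jk)).
  have h2 := ler_wpM2l (r0 `|k - j|%N) (deC j).
  have -> : 2 * d j * (2 * e k) = 4 * (d j * e k) by ring.
  rewrite distnC.
  have -> : 4 * C * rho ^+ `|k - j| * (2 ^ j) `^ lam =
    4 * (rho ^+ `|k - j| * (C * (2 ^ j) `^ lam)) by ring.
  by rewrite ler_pM2l//; apply: (le_trans h); rewrite mulrCA.
Qed.

End dyadic_weights.

(** * From condition (v) to the strong type *)

Section dyadic_subadditivity.
Context {R : realType}.
Import HBNNSimple.

(** Needed for integrands built from [Cop lam f], with no measurability at hand: the identity is
    applied to the simple functions below [g]. *)
Lemma le_integral_dyadic (g : R -> \bar R) : (forall x, (0 < x)%R -> 0 <= g x) ->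
  \int[leb]_(x in posR) g x <= \esum_(k in [set: int]) \int[leb]_(x in dyadic_itv k) g x.
Proof.
move=> g0; rewrite integral_mkcond ge0_integralTE; last first.
  by move=> x; apply: erestrict_ge0 => y /posRP/g0.
apply: ge_ereal_sup => _ [h hg <-].
rewrite -integralT_nnsfun.
have hg' x : posR x -> (h x)%:E <= g x.
  by move=> px; apply: (le_trans (hg x)); rewrite patchE mem_set.
have -> : \int[leb]_(x in setT) (h x)%:E = \int[leb]_(x in posR) (h x)%:E.
  rewrite [RHS]integral_mkcond; apply: eq_integral => x _.
  rewrite patchE; case: ifPn => // px; apply/eqP; rewrite eqe eq_le fun_ge0 andbT.
  by rewrite -lee_fin; apply: (le_trans (hg x)); rewrite patchE (negbTE px).
rewrite integral_dyadic; first last.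
- by move=> x _; rewrite lee_fin.
- by apply/measurable_EFinP; apply: measurable_funTS; exact: measurable_funP.
apply: le_esum => k _; apply: ge0_le_integral_nonmeas => x kx.
  by rewrite lee_fin.
by apply: hg'; exact: dyadic_itv_sub kx.
Qed.

End dyadic_subadditivity.

Section block_estimates.
Context {R : realType}.
Local Open Scope ring_scope.

Lemma powR_invl (t a : R) : 0 < t -> t^-1 `^ a = (t `^ a)^-1.
Proof.
by move=> t0; rewrite -[t^-1]powR_inv1 ?(ltW t0)// powRAC powR_inv1// powR_ge0.
Qed.

(* Young's inequality with the norms [s t] of [f u] and [be] of [v] *)
Lemma block_hoelder (p p' : R -> R) (u v f : R -> \bar R) (k : int) (s t be G c : R) :
  (forall x, 0 < x -> 1 < p x) -> (forall x, 0 < x -> 1 < p' x) ->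
  (forall x, 0 < x -> (p x)^-1 + (p' x)^-1 = 1) ->
  lmeas_fun p -> lmeas_fun p' -> lmeas_fun u -> lmeas_fun v -> lmeas_fun f ->
  (forall x, 0 < x -> (0 <= f x)%E) -> dual_weights u v ->
  0 < s -> 0 < t -> 0 < be -> 0 < G -> 0 < c ->
  (forall x, dyadic_itv k x -> G <= c * t `^ p x) ->
  (\int[leb]_(x in dyadic_itv k) f x <=
   (s * t * be * (c / G))%:E * modular p (dyadic_itv k) (fun x => f x * u x)%E s +
   (s * t * be)%:E * modular p' (dyadic_itv k) v be)%E.
Proof.
move=> p1 p'1 pp' mp mp' mu mv mf f0 uv s0 t0 be0 G0 c0 Gt.
have Jp : dyadic_itv k `<=` (posR : set R) by exact: dyadic_itv_sub.
have stb0 : 0 < s * t * be by rewrite !mulr_gt0.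
have cG0 : 0 < c / G by rewrite divr_gt0.
apply: (@ae_ge0_le_integral_lincomb _ (lebesgueR R)).
- exact: measurable_dyadic.
- by rewrite mulr_ge0 ?(ltW stb0) ?(ltW cG0).
- exact: ltW.
- by apply: measurable_funS mf; [exact: measurable_posR|exact: Jp].
- apply: measurable_modular; [exact: measurable_dyadic|exact: Jp|exact: mp|].
  by apply: emeasurable_funM; [exact: mf|exact: mu].
- by apply: measurable_modular; [exact: measurable_dyadic|exact: Jp|exact: mp'|exact: mv].
- by move=> x /Jp/posRP/f0.
- by move=> x _; exact: poweR_ge0.
- by move=> x _; exact: poweR_ge0.
apply: filterS uv => x + kx; have /posRP x0 := Jp _ kx => /(_ x0)[y y0 [-> ->]].
have := f0 _ x0; have px := p1 _ x0; have p'x := p'1 _ x0.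
(* Where [f] is infinite, the modular term on the right is infinite as well. *)
case: (f x) => [z||]//=; last first.
  move=> _; rewrite gt0_mulye ?lte_fin// gt0_mulye ?lte_fin ?invr_gt0//.
  rewrite poweRyr ?gt_eqF//; last lra.
  by rewrite gt0_muley ?lte_fin ?(mulr_gt0 stb0 cG0).
rewrite -!EFinM -!EFinD !lee_fin => z0.
have px0 : 0 < p x by lra. have p'x0 : 0 < p' x by lra.
have zys : 0 <= z * y / s by rewrite divr_ge0 ?mulr_ge0 ?(ltW y0) ?(ltW s0).
have ti0 : 0 <= t^-1 by rewrite invr_ge0 ltW.
have yb0 : 0 <= y^-1 / be by rewrite divr_ge0 ?invr_ge0 ?(ltW y0) ?(ltW be0).
(* The weight cancels in the product of the two factors; the power of 1/t is absorbed by [c / G]. *)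
have := @young_sum R 1 (p x) (p' x) (z * y / s * t^-1) (y^-1 / be) ltr01 px0 p'x0
  (pp' _ x0) (mulr_ge0 zys ti0) yb0.
rewrite invr1 powRr1; last exact: mulr_ge0 (mulr_ge0 zys ti0) yb0.
rewrite (powRM _ zys ti0) => h.
rewrite [leLHS](_ : z = s * t * be * (z * y / s * t^-1 * (y^-1 / be))); last first.
  by field; rewrite !gt_eqF.
have h2 := ler_wpM2l (ltW stb0) h; apply: (le_trans h2).
rewrite mulrDr lerD2r -[leRHS]mulrA ler_pM2l// [leLHS]mulrC ler_wpM2r ?powR_ge0//.
rewrite powR_invl// -[leLHS]mul1r ler_pdivrMr ?powR_gt0// mulrAC ler_pdivlMr// mul1r.
exact: Gt.
Qed.

(** The integrand is at most (t/c)^q (w/al)^q, and (t/c)^q <= t^p / c <= G because [t <= 1],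
    [p <= q] and [c >= 1]. This is the passage from [p] to [q]. *)
Lemma modular_block_le (p q : R -> R) (w g : R -> \bar R) (k : int) (t al G c Y : R) :
  lmeas_fun q -> lmeas_fun w ->
  (forall x, 0 < x -> 1 <= p x <= q x) -> (forall x, 0 < x -> (0 <= w x)%E) ->
  (forall x, 0 < x -> (0 <= g x)%E) ->
  0 < al -> 0 < t <= 1 -> 0 < Y -> 1 <= c -> 0 <= G ->
  (forall x, dyadic_itv k x -> t `^ p x <= c * G) ->
  (forall x, dyadic_itv k x -> (g x <= (Y * t / al)%:E)%E) ->
  (modular q (dyadic_itv k) w al <= 1)%E ->
  (modular q (dyadic_itv k) (fun x => g x * w x)%E (c * Y) <= G%:E)%E.
Proof.
move=> mq mw pq w0 g0 al0 /andP[t0 t1] Y0 c1 G0 tG gY hw.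
have c0 : 0 < c by lra.
apply: (@le_trans _ _ (G%:E * modular q (dyadic_itv k) w al)%E); last first.
  by rewrite -[leRHS]mule1 lee_wpmul2l// lee_fin.
rewrite -leb_integralZl; first last.
- by move=> x _; exact: poweR_ge0.
- by apply: measurable_modular; [exact: measurable_dyadic|exact: dyadic_itv_sub|
    exact: mq|exact: mw].
- exact: G0.
- exact: measurable_dyadic.
apply: ge0_le_integral_nonmeas => x kx; first exact: poweR_ge0.
have x0 := dyadic_itv_gt0 kx; have /andP[p1 pqx] := pq _ x0.
have q0 : 0 <= q x by lra.
have wx0 := w0 _ x0.
have ia0 : (0 <= al^-1%:E :> \bar R)%E by rewrite lee_fin invr_ge0 ltW.
apply: (@le_trans _ _ (((t / c)%:E * (w x * al^-1%:E)) `^ q x)%E).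
  apply: lee_poweR => //.
    apply: mule_ge0; first by rewrite mule_ge0 ?g0.
    by rewrite lee_fin invr_ge0 mulr_ge0 ?(ltW c0) ?(ltW Y0).
  have -> : ((t / c)%:E * (w x * al^-1%:E) = (Y * t / al)%:E * w x * ((c * Y)^-1)%:E)%E.
    rewrite muleCA -EFinM (muleC _ (w x)) -muleA -EFinM.
    by congr (_ * _%:E)%E; field; rewrite !gt_eqF.
  apply: lee_wpmul2r; first by rewrite lee_fin invr_ge0 mulr_ge0 ?(ltW c0) ?(ltW Y0).
  by apply: lee_wpmul2r => //; exact: gY.
have tc0 : 0 < t / c by rewrite divr_gt0.
rewrite poweRM ?lee_fin ?(ltW tc0) ?mule_ge0//.
apply: lee_wpmul2r; first exact: poweR_ge0.
rewrite poweR_EFin lee_fin.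
have ic : 0 < c^-1 <= 1 by rewrite invr_gt0 c0 invf_le1.
have [ic0 ic1] := andP ic.
rewrite powRM ?(ltW t0) ?(ltW ic0)//.
apply: (@le_trans _ _ (t `^ p x / c)); last by rewrite ler_pdivrMr// mulrC tG.
apply: ler_pM; rewrite ?powR_ge0//; first by apply: ger_powR; rewrite ?t0.
apply: ge1r_powR => //; lra.
Qed.

End block_estimates.

(** * The conjugate exponent *)

Section conjugate.
Context {R : realType}.
Local Open Scope ring_scope.

Lemma conj_expE (p : R -> R) (x : R) : 1 < p x -> (p x)^-1 + (conj_exp p x)^-1 = 1.
Proof. by move=> p1; rewrite /conj_exp invrK addrC subrK. Qed.

Lemma conj_exp_gt1 (p : R -> R) (x : R) : 1 < p x -> 1 < conj_exp p x.
Proof.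
move=> p1; rewrite /conj_exp.
have ip0 : 0 < (p x)^-1 by rewrite invr_gt0; lra.
have ip1 : (p x)^-1 < 1 by rewrite invf_lt1//; lra.
by rewrite invf_gt1; lra.
Qed.

Lemma conj_exp_le (p : R -> R) (pm x : R) : 1 < pm -> pm <= p x ->
  conj_exp p x <= (1 - pm^-1)^-1.
Proof.
move=> pm1 pmx; rewrite /conj_exp.
have ip1 : pm^-1 < 1 by rewrite invf_lt1//; lra.
have ip : (p x)^-1 <= pm^-1 by rewrite lef_pV2 ?posrE; lra.
by rewrite lef_pV2 ?posrE; lra.
Qed.

Lemma measurable_conj_exp (p : R -> R) : lmeas_fun p ->
  (forall x, 0 < x -> 1 < p x) -> lmeas_fun (conj_exp p).
Proof.
move=> mp p1.
apply: (@eq_measurable_fun _ _ (lebesgueR R) _ posR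
  (fun x => (1 - p x `^ (-1)) `^ (-1) : R)).
  move=> x; rewrite inE => /posRP x0; have px := p1 _ x0.
  have ip1 : (p x)^-1 < 1 by rewrite invf_lt1//; lra.
  by rewrite /conj_exp !powR_inv1//; lra.
apply: measurable_fun_powR; [exact: measurable_posR| |exact: measurable_cst].
apply: measurable_funB; first exact: measurable_cst.
by apply: measurable_fun_powR; [exact: measurable_posR|exact: mp|exact: measurable_cst].
Qed.

End conjugate.

Section sufficiency.
Context {R : realType}.
Local Open Scope ring_scope.

(** The roots of [G] inherit slow variation. For equal exponents, take the root of the hypothesis;
    otherwise [|j| <= |j - k|], and the geometric lower bound on [Gj] already suffices. *)
Lemma slowly_varying_root (s C Pj Pk Gj Gk : R) (j k : int) :
  0 < s < 1 -> 1 <= C -> 1 <= Pj -> 1 <= Pk -> 0 < Gj <= 1 -> 0 < Gk <= 1 ->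
  s ^+ `|j| <= C * Gj -> s ^+ `|j - k| * Gk <= Gj ->
  Pj = Pk \/ (`|j| <= `|j - k|)%N ->
  s ^+ `|j - k| * Gk `^ Pk^-1 <= C * Gj `^ Pj^-1.
Proof.
move=> /andP[s0 s1] C1 Pj1 Pk1 Gj01 Gk01 sG sGG.
have [Gj0 Gj1] := andP Gj01; have [Gk0 Gk1] := andP Gk01.
have sn n : 0 < s ^+ n <= 1 by rewrite exprn_gt0// exprn_ile1// ltW.
have iP1 : Pj^-1 <= 1 by rewrite invf_le1//; lra.
have iPk0 : 0 <= Pk^-1 by rewrite invr_ge0; lra.
have iPj0 : 0 <= Pj^-1 by rewrite invr_ge0; lra.
case=> [PE|jk].
  rewrite -PE; apply: (@le_trans _ _ (Gj `^ Pj^-1)); last first.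
    by rewrite ler_peMl// powR_ge0.
  apply: (@le_trans _ _ ((s ^+ `|j - k| * Gk) `^ Pj^-1)); last first.
    have [sn0 _] := andP (sn `|j - k|%N).
    by apply: ge0_ler_powR => //; rewrite nnegrE ?mulr_ge0 ?(ltW sn0) ?(ltW Gk0) ?(ltW Gj0).
  have [sn0 sn1] := andP (sn `|j - k|%N).
  rewrite powRM ?(ltW sn0) ?(ltW Gk0)// ler_wpM2r ?powR_ge0//.
  exact: ger1_powR.
have [sn0 sn1] := andP (sn `|j - k|%N).
apply: (@le_trans _ _ (s ^+ `|j - k|)).
  rewrite ler_piMr ?(ltW sn0)//.
  rewrite -[leRHS](congr1 (fun h => h Pk^-1) (@powR1 R)).
  by apply: ge0_ler_powR => //; rewrite nnegrE// ltW.
apply: (@le_trans _ _ (s ^+ `|j|)); first by apply: ler_wiXn2l; rewrite ?(ltW s0) ?(ltW s1).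
apply: (le_trans sG); rewrite ler_pM2l; last lra.
exact: ger1_powR.
Qed.

Lemma Apq0_strong_type (lam pm : R) (p q : R -> R) (w : R -> \bar R) :
  0 < lam <= 1 -> exponent p -> LH0 p -> LHoo p -> 1 < pm ->
  (forall x, 0 < x -> pm <= p x) -> exponent q ->
  (forall x, 0 < x -> (q x)^-1 = (p x)^-1 - (1 - lam)) -> weight w ->
  Apq0 lam p q w -> strong_type p q w (Cop lam).
Proof.
move=> /andP[lam0 lam1] hp hLH0 hLHoo pm1 pmp hq hpq [mw w0 _ aew] [C C0 HA].
have [L [P [P1 HP Pjk]]] := log_hoelder_dyadic hp hLH0 hLHoo.
have [mp p1 [Mp pM]] := hp; have [mq q1 [Mq qM]] := hq.
have p1' x : 0 < x -> 1 < p x by move=> /pmp; lra.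
pose p' := conj_exp p.
have mp' : lmeas_fun p' by exact: measurable_conj_exp.
have p'1 x : 0 < x -> 1 < p' x by move=> /p1'; exact: conj_exp_gt1.
pose v x := ((w x)^-1)%E.
have mv : lmeas_fun v.
  by apply: measurable_fun_inve; [exact: measurable_posR|exact: mw|move=> x /posRP/w0].
have v0 x : 0 < x -> (0 <= v x)%E by move=> x0; rewrite inve_ge0 w0.
have wv : dual_weights w v.
  apply: filterS aew => x + x0 => /(_ x0); rewrite /v.
  case: (w x) => [y||]//; last by rewrite ltxx andbF.
  rewrite lte_fin => /andP[y0 _]; exists y => //; split=> //.
  by rewrite inver gt_eqF.
pose M := Num.max Mq (1 - pm^-1)^-1.
have qbd x : 0 < x -> 1 <= q x <= M.
  by move=> x0; rewrite q1//= le_max qM.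
have p'bd x : 0 < x -> 1 <= p' x <= M.
  by move=> x0; rewrite ltW ?p'1//= le_max (conj_exp_le pm1 (pmp _ x0)) orbT.
have qp' x : 0 < x -> (q x)^-1 + (p' x)^-1 = lam.
  by move=> x0; have := conj_expE (p1' _ x0); rewrite -/p' hpq//; lra.
have HA' k : (ball_norm q w k * ball_norm p' v k <= (C * (2 ^ k) `^ lam)%:E)%E.
  by apply: HA; exact: exp2z_gt0.
have [rho [B [al [be [/andP[rho0 rho1] B0 albe0 albe1 albe]]]]] :=
  dyadic_weights lam0 qbd p'bd qp' mq mp' mw mv w0 v0 wv C0 HA'.
(* Half of the decay rate pays for replacing [t k] by [t j], the other half makes the sum over [k]
   converge. *)
pose sg := Num.sqrt rho.
have sg01 : 0 < sg < 1.
  by rewrite sqrtr_gt0 rho0 -[ltRHS]sqrtr1 ltr_sqrt.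
have [sg0 sg1] := andP sg01.
have rhoE n : rho ^+ n = sg ^+ n * sg ^+ n.
  by rewrite -expr2 -exprM mulnC exprM sqr_sqrtr// ltW.
have [Ga Ga1 HG] := slowly_varying_majorant sg01.
have [Cs Cs0 HCs] := esum_int_geometric sg01.
pose c := Num.max 1 ((Ga / sg) `^ L).
have c1 : 1 <= c by rewrite le_max lexx.
(* The two terms of [block_hoelder]: (c / G) times a modular at most [Ga * G], and a modular at most
   1. *)
pose C2 := c * Ga + 1.
have C20 : 0 < C2 by rewrite /C2; nra.
pose K0 := 2 `^ lam * C2 * B * Ga * Cs.
have K00 : 0 < K0.
  by rewrite !mulr_gt0 ?powR_gt0//; lra.
have pq x : 0 < x -> 1 <= p x <= q x.
  move=> x0; rewrite p1//= -lef_pV2 ?posrE; last 2 first.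
  - by have := q1 _ x0; lra.
  - by have := p1 _ x0; lra.
  by rewrite hpq//; lra.
exists (c * K0); first by rewrite mulr_gt0//; lra.
move=> f f0 [mf fw_fin].
have fw0 x : 0 < x -> (0 <= f x * w x)%E by move=> x0; rewrite mule_ge0 ?f0 ?w0.
have Cf0 x : 0 < x -> (0 <= Cop lam f x)%E.
  move=> x0; rewrite (CopE lam mf f0)//; apply: integral_ge0 => y /posRP y0.
  by rewrite mule_ge0 ?f0// lee_fin invr_ge0 powR_ge0.
have mfw : lmeas_fun (fun x => f x * w x)%E by apply: emeasurable_funM; [exact: mf|exact: mw].
have main s : 0 < s -> (modular p posR (fun x => f x * w x)%E s <= 1)%E ->
    (modular q posR (fun x => Cop lam f x * w x)%E (c * (K0 * s)) <= 1)%E.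
  move=> s0 hs.
  pose m k := modular p (dyadic_itv k) (fun x => f x * w x)%E s.
  have m0 k : (0 <= m k)%E by exact: modular_ge0.
  have sm : (\esum_(k in [set: int]) m k <= 1)%E.
    apply: le_trans hs; rewrite /modular integral_dyadic; first exact: lexx.
      apply: measurable_modular; [exact: measurable_posR|exact: subset_refl|
        exact: mp|exact: mfw].
    by move=> x _; exact: poweR_ge0.
  have [G [G01 sG mG sgG slowG]] := HG m m0 sm.
  (* Up to the factor [s], a majorant for the norm of [f w] on [J_k], computed with the constant
     exponent [P k]. *)
  pose t k := G k `^ (P k)^-1.
  have G0 k : 0 < G k by have /andP[] := G01 k.
  have t01 k : 0 < t k <= 1.
    rewrite powR_gt0//= -[leRHS](congr1 (fun h => h (P k)^-1) (@powR1 R)).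
    have Pk := P1 k.
    apply: ge0_ler_powR; rewrite ?nnegrE ?invr_ge0 ?(ltW (G0 k))//; first lra.
    by have /andP[] := G01 k.
  have t0 k : 0 < t k by have /andP[] := t01 k.
  have tP k : t k `^ P k = G k.
    have Pk := P1 k; have Pk0 : P k != 0 by apply/eqP; lra.
    by rewrite /t -powRrM mulVf// powRr1// ltW.
  have sgt k : sg ^+ `|k| <= Ga * t k.
    apply: (le_trans (sgG k)); rewrite ler_pM2l; last lra.
    by apply: ger1_powR; rewrite ?G01// invf_le1 ?P1//; have := P1 k; lra.
  have Gt k x : dyadic_itv k x -> G k <= c * t k `^ p x.
    move=> kx; have h := powR_exponent_perturb (a := P k) (b := p x) sg01 Ga1 (t01 k) (sgt k).
    rewrite -[leLHS]tP; apply: (le_trans (h L _)); first by rewrite distrC; exact: HP.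
    by rewrite ler_wpM2r ?powR_ge0// le_max lexx orbT.
  have tG k x : dyadic_itv k x -> t k `^ p x <= c * G k.
    move=> kx; have h := powR_exponent_perturb (a := p x) (b := P k) sg01 Ga1 (t01 k) (sgt k).
    rewrite -[G k]tP; apply: (le_trans (h L _)); first exact: HP.
    by rewrite ler_wpM2r ?powR_ge0// le_max lexx orbT.
  have F k : (\int[leb]_(x in dyadic_itv k) f x <= (s * t k * be k * C2)%:E)%E.
    have [al0 be0] := albe0 k; have [_ hbe] := albe1 k.
    have stb0 : 0 < s * t k * be k by rewrite !mulr_gt0.
    have c0 : 0 < c by lra.
    have cG0 : 0 < c / G k by rewrite divr_gt0.
    apply: (le_trans (block_hoelder (p' := p') (v := v) p1' p'1
      (fun x x0 => conj_expE (p1' x x0)) mp mp' mw mv mf f0 wv s0 (t0 k) be0 (G0 k) c0 (Gt k))).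
    apply: (@le_trans _ _ ((s * t k * be k * (c / G k))%:E * (Ga * G k)%:E +
       (s * t k * be k)%:E * 1)%E).
      apply: leeD; apply: lee_wpmul2l; [|exact: mG| |exact: hbe].
        by rewrite lee_fin mulr_ge0 ?(ltW stb0) ?(ltW cG0).
      by rewrite lee_fin ltW.
    rewrite mule1 -EFinM -EFinD lee_fin le_eqVlt; apply/orP; left; apply/eqP.
    by rewrite /C2; field; rewrite gt_eqF.
  have Cf j x : dyadic_itv j x -> (Cop lam f x <= (K0 * s * t j / al j)%:E)%E.
    move=> jx; have [al0 _] := albe0 j.
    apply: (le_trans (Cop_dyadic (ltW lam0) mf f0 jx)).
    pose A := 2 `^ lam * C2 * B * Ga * s * t j / al j.
    have A0 : 0 <= A by rewrite !mulr_ge0 ?powR_ge0 ?invr_ge0 ?ltW//; lra.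
    have sgn0 k : (0 <= (sg ^+ `|j - k|)%:E)%E by rewrite lee_fin exprn_ge0// ltW.
    apply: (@le_trans _ _ (\esum_(k in [set: int]) (A%:E * (sg ^+ `|j - k|)%:E))%E).
      apply: le_esum => k _.
      have X0 : 0 < (2 ^ Num.max j k) `^ lam :> R by rewrite powR_gt0 ?exp2z_gt0.
      have co0 : 0 <= 2 `^ lam / (2 ^ Num.max j k) `^ lam :> R.
        by rewrite divr_ge0 ?powR_ge0.
      apply: (@le_trans _ _ ((2 `^ lam / (2 ^ Num.max j k) `^ lam)%:E *
          (s * t k * be k * C2)%:E)%E); first by rewrite lee_wpmul2l ?lee_fin ?F.
      rewrite -!EFinM lee_fin.
      have h1 := slowly_varying_root sg01 Ga1 (P1 j) (P1 k) (G01 j) (G01 k) (sgG j)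
        (slowG j k) (Pjk j k).
      rewrite -/(t k) -/(t j) in h1.
      have h2 := albe j k; rewrite rhoE in h2.
      (* The power of 2^max(j,k) in the kernel cancels the one in the bound for [al j * be k]. *)
      have h3 : be k / (2 ^ Num.max j k) `^ lam <= B * (sg ^+ `|j - k| * sg ^+ `|j - k|) / al j.
        by rewrite ler_pdivrMr// mulrAC ler_pdivlMr// mulrC.
      have sn0 : 0 <= sg ^+ `|j - k| by rewrite exprn_ge0// ltW.
      have u0 : 0 <= 2 `^ lam * s * C2 by rewrite !mulr_ge0 ?powR_ge0 ?ltW.
      rewrite [leLHS](_ : _ = 2 `^ lam * s * C2 * (t k * (be k / (2 ^ Num.max j k) `^ lam)));
        last by ring.
      rewrite [leRHS](_ : _ = 2 `^ lam * s * C2 *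
        (B * sg ^+ `|j - k| / al j * (Ga * t j))); last by rewrite /A; ring.
      apply: ler_wpM2l => //.
      apply: (@le_trans _ _ (t k * (B * (sg ^+ `|j - k| * sg ^+ `|j - k|) / al j))).
        by rewrite ler_pM2l.
      rewrite [leLHS](_ : _ = B * sg ^+ `|j - k| / al j * (sg ^+ `|j - k| * t k));
        last by ring.
      by apply: ler_wpM2l => //; rewrite divr_ge0 ?mulr_ge0 ?(ltW B0) ?(ltW al0).
    apply: (le_trans (le_esumZl _ A0 sgn0)).
    apply: (@le_trans _ _ (A%:E * Cs%:E)%E); first by rewrite lee_wpmul2l ?lee_fin.
    rewrite -EFinM lee_fin le_eqVlt; apply/orP; left; apply/eqP.
    by rewrite /A /K0; ring.
  (* The modular on each [J_k] is at most [G k], and these sum to at most 1. *)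
  apply: le_trans sG; apply: (le_trans (le_integral_dyadic _)).
    by move=> x _; exact: poweR_ge0.
  apply: le_esum => k _.
  have [al0 _] := albe0 k; have [hal _] := albe1 k.
  apply: (modular_block_le (p := p) (t := t k) (al := al k)) => //.
  - by rewrite mulr_gt0.
  - exact: ltW.
  - exact: tG.
  - exact: Cf.
have cK0 : 0 < c * K0 by rewrite mulr_gt0//; lra.
have p0 x : 0 < x -> 0 < p x by move=> /p1; lra.
have Cw0 x : 0 < x -> (0 <= Cop lam f x * w x)%E by move=> x0; rewrite mule_ge0 ?Cf0 ?w0.
have := vnorm_ge0 p (fun x => f x * w x)%E.
case E : (vnorm p (fun x => f x * w x)%E) => [n||]// n0; last by rewrite E in fw_fin.
(* The scale is raised strictly above the norm [n]; the increment costs exactly [e] in the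
   result. *)
rewrite -EFinM; apply/lee_addgt0Pr => e e0; rewrite -EFinD.
have [s0 hs] : 0 < n + e / (c * K0) /\
    (modular p posR (fun x => f x * w x)%E (n + e / (c * K0)) <= 1)%E.
  by apply: modular_vnorm_lt => //; rewrite E lte_fin ltrDl divr_gt0.
have := main _ s0 hs; rewrite mulrA => h.
have h2 := vnorm_le_modular Cw0 (mulr_gt0 cK0 s0) h.
apply: (le_trans h2).
rewrite lee_fin le_eqVlt; apply/orP; left; apply/eqP.
by rewrite mulrDr [X in _ + X]mulrC divfK// gt_eqF.
Qed.

End sufficiency.

(** * From the weak type to condition (v) *)

Section exhaustion.
Context d (T : measurableType d) (R : realType) (mu : {measure set T -> \bar R}).

(** Monotone convergence along [E], after discarding the null set that the union misses. It extends
    a bound from sets where the weight is controlled to the whole interval. *)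
Lemma ae_exhaustion_integral_le (D : set T) (E : nat -> set T) (h : T -> \bar R)
    (c : \bar R) :
  measurable D -> (forall n, measurable (E n)) -> nondecreasing_seq E ->
  (forall n, E n `<=` D) -> {ae mu, forall x, D x -> exists n, E n x} ->
  measurable_fun D h -> (forall x, D x -> 0 <= h x) ->
  (forall n, \int[mu]_(x in E n) h x <= c) -> \int[mu]_(x in D) h x <= c.
Proof.
move=> mD mE ndE ED [N [mN N0 DN]] mh h0 hc.
have mU : measurable (\bigcup_n E n) by exact: bigcupT_measurable.
have UD : \bigcup_n E n `<=` D by move=> x [n _ /ED].
apply: (@le_trans _ _ (\int[mu]_(x in \bigcup_n E n) h x)).
  rewrite (ge0_negligible_integral mN mD mh h0 N0); apply: ge0_subset_integral => //.
  - exact: measurableD.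
  - exact: measurable_funS mh.
  - by move=> x /UD/h0.
  - move=> x [Dx Nx]; apply: contrapT => Ux; apply: Nx; apply: DN => /= /(_ Dx)[n En].
    by apply: Ux; exists n.
have cvgE : \int[mu]_(x in E i) h x @[i --> \oo] --> \int[mu]_(x in \bigcup_i E i) h x.
  apply: ge0_nondecreasing_set_cvg_integral => //.
    by move=> n; exact: measurable_funS mh.
  by move=> n x /ED/h0.
rewrite -(cvg_lim _ cvgE)//; apply: lime_le; first by apply/cvg_ex; eexists; exact: cvgE.
exact: nearW.
Qed.

End exhaustion.

Section necessity.
Context {R : realType}.
Local Open Scope ring_scope.

Variables (lam pm K b N : R) (p q : R -> R) (w : R -> \bar R) (E : set R).
Hypotheses (lam0 : 0 < lam) (pm1 : 1 < pm) (pmp : forall x, 0 < x -> pm <= p x).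
Hypotheses (q0 : forall x, 0 < x -> 0 < q x) (mp : lmeas_fun p).
Hypotheses (mw : lmeas_fun w) (w0 : forall x, 0 < x -> (0 <= w x)%E).
Hypotheses (K0 : 0 < K) (b0 : 0 < b) (N0 : 0 < N).
Hypothesis weakS : forall (mu : R) (f : R -> \bar R), 0 < mu ->
  (forall x : R, 0 < x -> (0 <= f x)%E) -> Lw p w f ->
  (mu%:E * vnorm q (fun x =>
     w x * (\1_[set y : R | 0 < y /\ (mu%:E < Sop lam f y)%E] x)%:E)
   <= K%:E * vnorm p (fun x => f x * w x))%E.
Hypothesis N_le : (N%:E <= vnorm q (fun x => w x * (\1_(`]0, b[%classic : set R) x)%:E))%E.
Hypotheses (mE : @measurable _ (lebesgueR R) E) (Eb : E `<=` `]0, b[%classic).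
Hypothesis wE : exists2 c : R, 0 < c & forall x, E x -> exists2 y : R, c <= y & w x = y%:E.

Let p1 x : 0 < x -> 1 < p x. Proof. by move=> /pmp; exact: lt_le_trans. Qed.
Let p'1 x : 0 < x -> 1 < conj_exp p x. Proof. by move=> /p1; exact: conj_exp_gt1. Qed.

Let v x := ((w x)^-1)%E.
(** The bound to be shown for the norm of [v] on [E]. Here [N] is any positive real below the norm
    of [w] on (0, b), which might be infinite. *)
Let A := K * (2 * b) `^ lam / N.
Let h x := ((v x * A^-1%:E) `^ conj_exp p x)%E.

Let b2_gt0 : 0 < (2 * b) `^ lam. Proof. by rewrite powR_gt0// mulr_gt0. Qed.
Let A_gt0 : 0 < A. Proof. by rewrite divr_gt0// mulr_gt0. Qed.
Let EpR : E `<=` (posR : set R).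
Proof. by move=> x /Eb; rewrite posRP /= in_itv/= => /andP[]. Qed.

Let mv : lmeas_fun v.
Proof. by apply: measurable_fun_inve; [exact: measurable_posR|exact: mw|move=> x /posRP/w0]. Qed.

Let mh : lmeas_fun h.
Proof.
apply: measurable_modular; [exact: measurable_posR|exact: subset_refl| |exact: mv].
exact: measurable_conj_exp.
Qed.

Let h_ge0 x : (0 <= h x)%E. Proof. exact: poweR_ge0. Qed.

(** On [E] the function [v] is bounded, [conj_exp p] is bounded since [p >= pm > 1], and [E] has
    finite measure. Finiteness is what the argument by contradiction below rests on. *)
Lemma modular_bounded_fin : (modular (conj_exp p) E v A < +oo)%E.
Proof.
have [c c0 wc] := wE.
pose H := Num.max 1 (c^-1 / A) `^ ((1 - pm^-1)^-1).
apply: (@le_lt_trans _ _ (\int[leb]_(x in E) (cst H%:E x))%E).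
  apply: ge0_le_integral_nonmeas => x Ex; first exact: poweR_ge0.
  have /posRP x0 := EpR Ex; have [y cy wy] := wc _ Ex.
  have y0 : 0 < y by lra.
  rewrite /v wy inver gt_eqF// -EFinM poweR_EFin lee_fin.
  have m1 : 1 <= Num.max 1 (c^-1 / A) by rewrite le_max lexx.
  have iA0 : 0 <= A^-1 by rewrite invr_ge0 ltW.
  have iy0 : 0 <= y^-1 by rewrite invr_ge0 ltW.
  apply: (@le_trans _ _ (Num.max 1 (c^-1 / A) `^ conj_exp p x)).
    apply: ge0_ler_powR; rewrite ?nnegrE ?mulr_ge0//.
    - by have := p'1 x0; lra.
    - by apply: (le_trans ler01).
    - rewrite le_max; apply/orP; right.
      by rewrite ler_wpM2r// lef_pV2// posrE.
  by apply: ler_powR => //; exact: conj_exp_le (pmp x0).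
rewrite integral_cst; last exact: mE.
apply: lte_mul_pinfty => //; first by rewrite lee_fin powR_ge0.
apply: (@le_lt_trans _ _ (leb (`]0, b[%classic : set R))).
  by apply: le_measure; rewrite ?inE; [exact: mE|exact: measurable_itv_leb|exact: Eb].
by rewrite lebE lebesgue_measure_itv/= lte_fin b0 -EFinB ltry.
Qed.

(** If the modular [V] exceeded 1, the test function [f = A h] on [E] would satisfy |f w|_p <=
    V^(1/pm) < V, while [Sop lam f >= (K / N) V] on (0, b); the weak type at a level in between is
    violated. *)
Lemma weak_type_test : (modular (conj_exp p) E v A <= 1)%E.
Proof.
have [c c0 wc] := wE.
rewrite leNgt; apply/negP => V1.
have := modular_bounded_fin; have V0 := modular_ge0 (conj_exp p) E v A.
case VE : (modular (conj_exp p) E v A) V1 V0 => [V||]//; rewrite !lte_fin lee_fin => V1 _ _.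
have V0 : 0 < V by lra.
(* As [V > 1] and [p >= pm], the power s^p is at least [V]. *)
pose s := V `^ pm^-1.
have s0 : 0 < s by rewrite powR_gt0.
have sV : s < V.
  rewrite -[ltRHS](powRr1 (ltW V0)) /s /powR gt_eqF// ltr_expR ltr_pM2r ?ln_gt0//.
  by rewrite invf_lt1//; have := pm1; lra.
pose f x := (A%:E * h x * (\1_E x)%:E)%E.
have f0 x : (0 <= f x)%E by rewrite !mule_ge0// lee_fin ltW.
have mf : lmeas_fun f.
  apply: emeasurable_funM; first by apply: measurable_funeM; exact: mh.
  by apply/measurable_EFinP; apply: measurable_funTS; exact: measurable_indic.
pose g x := (A%:E * h x * w x)%E.
have fwE x : (f x * w x = g x * (\1_E x)%:E)%E by rewrite /f /g muleAC.
have p0 x : 0 < x -> 0 < p x by move=> /p1; lra.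
have fw0 x : 0 < x -> (0 <= f x * w x)%E by move=> x0; rewrite mule_ge0// w0.
have norm_f : (vnorm p (fun x => f x * w x)%E <= s%:E)%E.
  apply: vnorm_le_modular => //.
  rewrite (_ : (fun x => f x * w x)%E = (fun x => g x * (\1_E x)%:E)%E); last first.
    by apply/funext.
  rewrite modular_restrict//.
  apply: (@le_trans _ _ (V^-1%:E * modular (conj_exp p) E v A)%E); last first.
    by rewrite VE -EFinM mulVf// gt_eqF.
  rewrite -leb_integralZl; first last.
  - by move=> x _; exact: poweR_ge0.
  - apply: measurable_modular; [exact: mE|exact: EpR| |exact: mv].
    exact: measurable_conj_exp.
  - by rewrite invr_ge0 ltW.
  - exact: mE.
  apply: ge0_le_integral_nonmeas => x Ex; first exact: poweR_ge0.
  have /posRP x0 := EpR Ex; have [y cy wy] := wc _ Ex.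
  have y0 : 0 < y by lra.
  have px1 := p1 x0.
  rewrite /g /h /v wy inver gt_eqF// -EFinM !poweR_EFin -!EFinM ?poweR_EFin -?EFinM lee_fin.
  set X := y^-1 / A; set e := conj_exp p x.
  have X0 : 0 < X by rewrite divr_gt0 ?invr_gt0.
  (* [A * y] is the inverse of [X]; next, [(e - 1) p = e] for conjugate exponents. *)
  have -> : A * X `^ e * y = X `^ (e - 1).
    rewrite powRB ?(gt_eqF X0) ?implybT// powRr1 ?(ltW X0)// /X.
    by field; rewrite !gt_eqF.
  rewrite powRM ?powR_ge0 ?invr_ge0 ?(ltW s0)// -powRrM.
  have -> : (e - 1) * p x = e.
    rewrite /e /conj_exp; field.
    by apply/andP; split; apply/eqP; lra.
  rewrite mulrC ler_wpM2r ?powR_ge0// powR_invl// lef_pV2 ?posrE ?powR_gt0//.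
  rewrite /s -powRrM -[leLHS](powRr1 (ltW V0)); apply: ler_powR; first exact: ltW.
  by rewrite mulrC ler_pdivlMr ?mul1r ?pmp//; have := pm1; lra.
have Lwf : Lw p w f by split=> //; apply: (le_lt_trans norm_f); rewrite ltry.
have b2 : 0 < 2 * b by rewrite mulr_gt0.
have S_ge x : 0 < x < b -> ((A / (2 * b) `^ lam * V)%:E <= Sop lam f x)%E.
  move=> /andP[x0 xb].
  have mk : @measurable_fun _ _ (lebesgueR R) _ posR
      (fun y => f y * (((x + y) `^ lam)^-1)%:E)%E.
    by apply: measurable_fun_kernelM => //; exact: measurable_funD.
  have k0 y : (0 <= f y * (((x + y) `^ lam)^-1)%:E)%E.
    by rewrite mule_ge0// lee_fin invr_ge0 powR_ge0.
  apply: (@le_trans _ _ (\int[leb]_(y in E) (f y * (((x + y) `^ lam)^-1)%:E))%E); last first.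
    apply: (@ge0_subset_integral _ (lebesgueR R) R leb _ _ mE measurable_posR _ mk).
    - by move=> y _; exact: k0.
    - exact: EpR.
  rewrite EFinM -VE -leb_integralZl; first last.
  - by move=> y _; exact: poweR_ge0.
  - apply: measurable_modular; [exact: mE|exact: EpR| |exact: mv].
    exact: measurable_conj_exp.
  - by rewrite divr_ge0 ?powR_ge0 ?(ltW A_gt0).
  - exact: mE.
  have c20 : (0 <= (A / (2 * b) `^ lam)%:E :> \bar R)%E.
    by rewrite lee_fin divr_ge0 ?powR_ge0 ?(ltW A_gt0).
  apply: ge0_le_integral_nonmeas => y Ey; first by rewrite mule_ge0// poweR_ge0.
  have := Eb Ey; rewrite /= in_itv/= => /andP[y0 yb].
  rewrite /f indicE mem_set// mule1 muleAC -EFinM -/(h y).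
  apply: lee_wpmul2r => //; rewrite lee_fin ler_pM2l// lef_pV2 ?posrE ?powR_gt0 ?addr_gt0//.
  by apply: ge0_ler_powR; rewrite ?nnegrE ?(ltW lam0) ?(ltW b2) ?addr_ge0 ?(ltW x0) ?(ltW y0)//; lra.
(* Below [(K / N) V], so the level set contains (0, b); above [(K / N) s], so the weak-type
   inequality fails. *)
pose mu := K / N * ((s + V) / 2).
have KN0 : 0 < K / N by rewrite divr_gt0.
have mu0 : 0 < mu by rewrite mulr_gt0//; lra.
have muV : mu < A / (2 * b) `^ lam * V.
  rewrite (_ : A / _ * V = K / N * V); last by rewrite /A; field; rewrite !gt_eqF.
  by rewrite ltr_pM2l//; lra.
have := weakS mu0 (fun x _ => f0 x) Lwf.
apply/negP; rewrite -ltNge.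
have K0e : (0 <= K%:E :> \bar R)%E by rewrite lee_fin ltW.
apply: (le_lt_trans (lee_wpmul2l K0e norm_f)).
apply: (@lt_le_trans _ _ (mu%:E * N%:E)%E).
  rewrite -!EFinM lte_fin /mu (_ : _ * N = K * ((s + V) / 2)); last first.
    by field; rewrite gt_eqF.
  by rewrite ltr_pM2l//; lra.
apply: lee_wpmul2l; first by rewrite lee_fin ltW.
apply: (le_trans N_le); apply: vnorm_le => x x0; first exact: ltW (q0 x0).
rewrite !abseM (gee0_abs (w0 x0)); apply: lee_wpmul2l; first exact: w0.
rewrite !gee0_abs ?lee_fin// !indicE.
case: (boolP (x \in _)) => //; rewrite inE /= in_itv/= => xb.
rewrite mem_set//=; split=> //; apply: (lt_le_trans _ (S_ge _ xb)).
by rewrite lte_fin.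
Qed.

End necessity.

(** * Transfer between the operators and between strong and weak type *)

Section equivalences.
Context {R : realType}.
Local Open Scope ring_scope.
Variables (lam : R) (p q : R -> R) (w : R -> \bar R).
Hypotheses (lam0 : 0 < lam) (q0 : forall x, 0 < x -> 0 < q x).
Hypothesis w0 : forall x, 0 < x -> (0 <= w x)%E.

Let Sop_ge0 (f : R -> \bar R) (x : R) :
  (forall x, 0 < x -> (0 <= f x)%E) -> (0 <= Sop lam f x)%E.
Proof.
move=> f0; apply: integral_ge0 => y /posRP y0.
by rewrite mule_ge0 ?f0// lee_fin invr_ge0 powR_ge0.
Qed.

Lemma strong_type_Sop : strong_type p q w (Cop lam) -> strong_type p q w (Sop lam).
Proof.
move=> [K K0 HK]; exists K; first exact: K0.
move=> f f0 hf; apply: le_trans (HK f f0 hf).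
apply: vnorm_le => x x0; first exact: ltW (q0 x0).
have S0 := Sop_ge0 x f0; have SC := Sop_le_Cop (ltW lam0) hf.1 f0 x0.
rewrite !abseM (gee0_abs (w0 x0)) (gee0_abs S0) (gee0_abs (le_trans S0 SC)).
by apply: lee_wpmul2r; first exact: w0.
Qed.

(** Chebyshev's inequality: on the level set mu <= Cop f <= 2^lam Sop f. *)
Lemma strong_type_weak_type_Cop :
  strong_type p q w (Sop lam) -> weak_type p q w (Cop lam).
Proof.
move=> [K K0 HK]; have l2 : 0 < 2 `^ lam :> R by rewrite powR_gt0.
exists (2 `^ lam * K); first by rewrite mulr_gt0.
move=> mu f mu0 f0 hf.
have hS := HK f f0 hf.
have KE : ((2 `^ lam * K)%:E = (2 `^ lam)%:E * K%:E :> \bar R)%E by rewrite EFinM.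
rewrite KE -muleA -lee_pdivrMl// muleA -EFinM.
apply: le_trans hS; apply: vnorm_le_scale.
- by rewrite mulr_gt0// invr_gt0.
- by move=> x x0; exact: ltW (q0 x0).
move=> x x0; have S0 := Sop_ge0 x f0; have CS := Cop_le_Sop (ltW lam0) hf.1 f0 x0.
rewrite !abseM (gee0_abs (w0 x0)) (gee0_abs S0) gee0_abs ?lee_fin// muleCA muleC.
apply: lee_wpmul2r; first exact: w0.
rewrite indicE; case: (boolP (x \in _)) => [|_]; last by rewrite mule0.
rewrite inE /= => -[_ muC]; rewrite mule1 EFinM lee_pdivrMl//.
exact: ltW (lt_le_trans muC CS).
Qed.

Lemma weak_type_Sop : weak_type p q w (Cop lam) -> weak_type p q w (Sop lam).
Proof.
move=> [K K0 HK]; exists K; first exact: K0.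
move=> mu f mu0 f0 hf; apply: le_trans (HK mu f mu0 f0 hf).
apply: lee_wpmul2l; first by rewrite lee_fin ltW.
apply: vnorm_le => x x0; first exact: ltW (q0 x0).
rewrite !abseM (gee0_abs (w0 x0)); apply: lee_wpmul2l; first exact: w0.
rewrite !gee0_abs ?lee_fin// !indicE.
case: (boolP (x \in [set y | 0 < y /\ (mu%:E < Sop lam f y)%E]%classic)) => //.
rewrite inE /= => -[_ muS]; rewrite mem_set//=; split=> //.
exact: lt_le_trans muS (Sop_le_Cop (ltW lam0) hf.1 f0 x0).
Qed.

Lemma weak_type_Apq0 (pm : R) : 1 < pm -> (forall x, 0 < x -> pm <= p x) ->
  lmeas_fun p -> weight w -> weak_type p q w (Sop lam) -> Apq0 lam p q w.
Proof.
move=> pm1 pmp mp [mw _ _ aew] [K K0 HK].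
exists (K * 2 `^ lam); first by rewrite mulr_gt0// powR_gt0.
move=> b b0; set N := vnorm q _; set V := vnorm _ _.
pose D : set R := `]0, b[%classic.
have Dp : D `<=` (posR : set R).
  by move=> x; rewrite posRP /D /= in_itv/= => /andP[].
have mD : @measurable _ (lebesgueR R) D by exact: measurable_itv_leb.
have p1 x : 0 < x -> 1 < p x by move=> /pmp; exact: lt_le_trans.
have p'0 x : 0 < x -> 0 < conj_exp p x.
  by move=> /p1/conj_exp_gt1; exact: lt_trans.
have mp' : lmeas_fun (conj_exp p) by exact: measurable_conj_exp.
pose v x := ((w x)^-1)%E.
have v0 x : 0 < x -> (0 <= v x)%E by move=> x0; rewrite inve_ge0 w0.
have mv : lmeas_fun v.
  by apply: measurable_fun_inve; [exact: measurable_posR|exact: mw|move=> x /posRP/w0].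
have mwD : @measurable_fun _ _ (lebesgueR R) _ D w.
  by apply: measurable_funS mw; [exact: measurable_posR|exact: Dp].
(* Stated for all reals [N'] below [N], so that an infinite [N] is covered too. *)
have V_le N' : 0 < N' -> (N'%:E <= N)%E -> (V <= (K * (2 * b) `^ lam / N')%:E)%E.
  move=> N'0 N'N; set A := K * (2 * b) `^ lam / N'.
  have A0 : 0 < A by rewrite divr_gt0 ?mulr_gt0 ?powR_gt0 ?mulr_gt0.
  apply: vnorm_restrict_le => //.
  pose E (n : nat) : set R := ((D `&` [set x | (n.+1%:R^-1)%:E <= w x]%E) `&`
    (D `&` [set x | w x <= n.+1%:R%:E]%E))%classic.
  have mE n : @measurable _ (lebesgueR R) (E n).
    apply: measurableI.
      exact: emeasurable_fun_c_infty.
    exact: emeasurable_fun_infty_c.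
  have ED n : E n `<=` D by move=> x [[]].
  have ndE : nondecreasing_seq E.
    move=> m n mn; apply/subsetPset => x [[Dx wl] [_ wu]].
    split; split=> //=; [apply: le_trans wl|apply: (le_trans wu)]; rewrite lee_fin.
      by rewrite lef_pV2 ?posrE// ler_nat ltnS.
    by rewrite ler_nat ltnS.
  have aeE : {ae leb, forall x : lebesgueR R, D x -> exists n, E n x}.
    apply: filterS aew => x + Dx; have /posRP x0 := Dp _ Dx => /(_ x0).
    case wx : (w x) => [y||]//; last by rewrite ltxx andbF.
    rewrite lte_fin => /andP[y0 _].
    pose n := maxn (Num.truncn y) (Num.truncn y^-1).
    have n1 : y <= n.+1%:R.
      by apply: (ltW (lt_le_trans (truncnS_gt _) _)); rewrite ler_nat ltnS leq_maxl.
    have n2 : y^-1 <= n.+1%:R.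
      by apply: (ltW (lt_le_trans (truncnS_gt _) _)); rewrite ler_nat ltnS leq_maxr.
    exists n; split; split=> //=; rewrite wx lee_fin//.
    by rewrite -[leRHS]invrK lef_pV2 ?posrE ?invr_gt0.
  apply: (@ae_exhaustion_integral_le _ (lebesgueR R) R leb D E).
  - exact: mD.
  - exact: mE.
  - exact: ndE.
  - exact: ED.
  - exact: aeE.
  - exact: measurable_modular.
  - by move=> x _; exact: poweR_ge0.
  move=> n; apply: (@weak_type_test R lam pm K b N' p q w (E n)) => //.
  exists n.+1%:R^-1; first by rewrite invr_gt0.
  move=> x [[_ /= wl] [_ /= wu]].
  case wx : (w x) wl wu => [y||]//; rewrite !lee_fin => yl _.
  by exists y.
have Kb : K * (2 * b) `^ lam = K * 2 `^ lam * b `^ lam.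
  by rewrite powRM// ?mulrA// ltW.
have V0 : (0 <= V)%E by exact: vnorm_ge0.
have : (0 <= N)%E by exact: vnorm_ge0.
(* For [N = 0] the product vanishes; for finite positive [N], take [N' = N]. *)
case NE : N => [n||]// n0.
  rewrite lee_fin in n0; move: n0; rewrite le_eqVlt => /predU1P[<-|n0].
    by rewrite mul0e lee_fin !mulr_ge0 ?powR_ge0 ?(ltW K0).
  have := V_le n n0; rewrite NE lexx => /(_ isT) h.
  by rewrite muleC -lee_pdivlMr// (le_trans h)// -EFinM Kb.
(* For infinite [N], letting [N'] grow forces [V = 0], and then the product is 0 by convention. *)
have -> : V = 0%E.
  apply/eqP; rewrite eq_le V0 andbT; apply/lee_addgt0Pr => e e0; rewrite add0e.
  have c0 : 0 < K * (2 * b) `^ lam by rewrite mulr_gt0 ?powR_gt0 ?mulr_gt0.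
  have := V_le (K * (2 * b) `^ lam / e); rewrite NE leey divr_gt0// => /(_ isT isT).
  by rewrite invfM invrK mulrA mulfV ?mul1r// gt_eqF.
by rewrite mule0 lee_fin !mulr_ge0 ?powR_ge0 ?(ltW K0).
Qed.

End equivalences.

Theorem theorem1p8 (R : realType) (lam : R) (p q : R -> R) (w : R -> \bar R)
    (hlam : (0 < lam <= 1)%R)
    (hp : exponent p) (hp0 : LH0 p) (hpoo : LHoo p)
    (hp_inf : (1 < exp_inf p)%E)
    (hp_le : (exp_inf p <= exp_sup p)%E)
    (hp_sup : (exp_sup p < ((1 - lam)%R%:E)^-1)%E)
    (hq : exponent q)
    (hpq : forall x : R, (0 < x)%R -> ((q x)^-1 = (p x)^-1 - (1 - lam))%R)
    (hw : weight w) :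
  [<-> strong_type p q w (Cop lam);
       strong_type p q w (Sop lam);
       weak_type p q w (Cop lam);
       weak_type p q w (Sop lam);
       Apq0 lam p q w].
Proof.
have lam0 : (0 < lam)%R by have /andP[] := hlam.
have [mp p1 _] := hp; have [_ q1 _] := hq; have [_ w0 _ _] := hw.
have q0 x : (0 < x)%R -> (0 < q x)%R by move=> /q1; exact: lt_le_trans.
(* The infimum of [p] is itself a real number, since it exceeds 1 and is at most the value of [p] at
   1. *)
have [pm pm1 pmp] : exists2 pm : R, (1 < pm)%R & forall x, (0 < x)%R -> (pm <= p x)%R.
  have lb x : (0 < x)%R -> exp_inf p <= (p x)%:E.
    by move=> x0; apply: ereal_inf_lbound; exists x => //; exact/posRP.
  move: hp_inf lb; case: (exp_inf p) => [r||]//.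
    by rewrite lte_fin => r1 lb; exists r => // x /lb; rewrite lee_fin.
  by move=> _ /(_ _ ltr01).
tfae.
- exact: strong_type_Sop.
- exact: strong_type_weak_type_Cop.
- exact: weak_type_Sop.
- exact: (weak_type_Apq0 lam0 q0 w0 pm1 pmp mp hw).
- exact: (Apq0_strong_type hlam hp hp0 hpoo pm1 pmp hq hpq hw).
Qed.
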